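(* Let $n \geq 2$ and let $\lambda$ be a partition of $n$ chosen from the Plancherel measure of the symmetric group $S_n$, and set $T_n(\lambda) = \frac{\sqrt{\binom{n}{2}}\,\chi^{\lambda}((12))}{\dim(\lambda)}$. There is a universal constant $C$ (independent of $n$ and $x_0$) such that for all $n \geq 2$ and all real $x_0$, \[ \left| \mathbb{P}\left( T_n(\lambda) \leq x_0 \right) - \frac{1}{\sqrt{2\pi}} \int_{-\infty}^{x_0} e^{-t^2/2}\, dt \right| \leq C n^{-1/2}. \]
   Context: Irreducible representations of $S_n$ are indexed by partitions $\lambda$ of $n$; $\chi^\lambda$ is the irreducible character and $\dim(\lambda)$ its dimension. The Plancherel measure chooses $\lambda$ with probability $\dim(\lambda)^2/n! = n!/\prod_{x\in\lambda} h(x)^2$, where $h(x)$ is the hooklength of box $x$. $\chi^{\lambda}((12))$ denotes the character evaluated at a transposition. Equivalently (Frobenius' formula), $\frac{\chi^\lambda((12))}{\dim(\lambda)} = \binom{n}{2}^{-1}\sum_i \left(\binom{\lambda_i}{2} - \binom{\lambda_i'}{2}\right)$, where $\lambda_i$ and $\lambda_i'$ are the lengths of the $i$-th row and $i$-th column of $\lambda$. *)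

(* Defs.v *)
From HB Require Import structures.
From mathcomp Require Import all_boot all_order all_algebra.
From mathcomp Require Import all_classical all_reals all_analysis.
Set Implicit Arguments. Unset Strict Implicit. Unset Printing Implicit Defensive.
Import Order.TTheory GRing.Theory Num.Theory.
Local Open Scope ring_scope.

(* A sequence s of naturals (rows lambda_1 >= lambda_2 >= ..., padded with
   zeros) is a partition of n. *)
Definition is_partition (n : nat) (s : seq nat) : bool :=
  sorted geq s && (sumn s == n).

Definition colLen (s : seq nat) (j : nat) : nat := count (fun x => j < x)%N s.

(* hook length of box (i,j) (0-indexed), for j < lambda_i *)
Definition hook (s : seq nat) (i j : nat) : nat :=
  (nth 0 s i - j + colLen s j - i - 1)%N.

Definition hookProd (s : seq nat) : nat :=
  (\prod_(i < size s) \prod_(j < nth 0 s i) hook s i j)%N.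

(* Plancherel weight dim(lambda)^2 / n! = n! / prod h(x)^2 *)
Definition plancherel {R : realType} (n : nat) (s : seq nat) : R :=
  (n`!)%:R / ((hookProd s) ^ 2)%:R.

(* chi^lambda((12)) / dim(lambda), via Frobenius' formula
   binom(n,2)^{-1} sum_i (binom(lambda_i,2) - binom(lambda'_i,2));
   for a partition of n both rows and columns have index < n. *)
Definition charRatio {R : realType} (n : nat) (s : seq nat) : R :=
  (\sum_(i < n) (('C(nth 0 s i, 2))%:R - ('C(colLen s i, 2))%:R)) / ('C(n, 2))%:R.

Definition Tn {R : realType} (n : nat) (s : seq nat) : R :=
  Num.sqrt (('C(n, 2))%:R) * charRatio n s.

(* Partitions of n are encoded as n-tuples of entries in {0..n}, i.e. the
   rows lambda_1,...,lambda_n (at most n rows), padded with zeros. *)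
Definition rows (n : nat) (t : n.-tuple 'I_n.+1) : seq nat := map val t.

Definition probT {R : realType} (n : nat) (x0 : R) : R :=
  \sum_(t : n.-tuple 'I_n.+1 | is_partition n (rows t) && (Tn n (rows t) <= x0))
     plancherel n (rows t).

Definition normalCDF {R : realType} (x0 : R) : R :=
  (Num.sqrt (2 * pi))^-1 *
  Rintegral (@lebesgue_measure R) `]-oo, x0]%classic (fun t : R => expR (- (t ^+ 2) / 2)).

(* Main.v *)
Require Import Defs.
From HB Require Import structures.
From mathcomp Require Import all_boot all_order all_algebra.
From mathcomp Require Import all_classical all_reals all_analysis.
From mathcomp Require Import ring lra zify.
Set Implicit Arguments. Unset Strict Implicit. Unset Printing Implicit Defensive.
Import Order.TTheory GRing.Theory Num.Theory.
Local Open Scope ring_scope.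

(* Stein's method with an exchangeable pair, in the form of Shao and Zhang that
   needs no bound on the increments. Let mu be a Plancherel partition of n - 1,
   add to mu two boxes, independently, by the Plancherel growth rule, and call
   la, la' the two partitions of n so obtained: they form an exchangeable pair of
   Plancherel partitions. By Frobenius' formula T_n is S_1 / sqrt C(n,2), where S_r
   is the sum of the r-th powers of the contents, so the increment of T_n along the
   pair is a difference of two contents. Its first three conditional moments given
   la are explicit in S_1, S_2, S_3: the moments of the content of an added (resp.
   removed) box are the coefficients of the rational function
     prod (1 - (x_j - 1) u) / ((1 + N u) prod (1 - x_j u)),   x_j = la_j - j,
   (resp. of its inverse), and Newton's identities express them through the S_r.
   Along the growth process S_1, S_2, S_3 have explicit low moments, which
   makes the three error terms of Stein's bound O(n^(-1/2)). *)

(** * Partial fractions and Newton identities *)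

(** A content can be as large as [n - 1], so the increments of T_n are not uniformly of order
    n^(-1/2), and a Stein bound based on their maximum would call for tail estimates on the longest
    row and column. Instead [|W' - W|] in the remainder is majorised by
    [d / 2 + (W' - W)^2 / (2 d)], an even function of the increment: exchangeability then leaves
    only the conditional moments of orders 1 and 3. The third one contains S_3, whose size is
    measured by E S_3^2, hence by the sixth moment of an added content; the second one deviates from
    its target by a multiple of S_2 - E S_2, whose variance calls for the fourth moment. The
    rational functions are treated as polynomial identities modulo a power of ['X]. Shapes of all
    sizes up to N = n live on the same N rows; a shape of size less than N has an empty last row, so
    growth never runs out of rows. *)

Section PowerSeries.
Variable R : realFieldType.
Implicit Types (xs ys : seq R) (H : {poly R}).

Definition rootProd xs : {poly R} := \prod_(s <- xs) (1 - s *: 'X).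

Definition psum xs (r : nat) : R := \sum_(s <- xs) s ^+ r.

Definition psumPoly K xs : {poly R} := \poly_(r < K) psum xs r.+1.

Lemma geometric_poly K (s : R) :
  (1 - s *: 'X) * (\poly_(k < K) s ^+ k) = 1 - s ^+ K *: 'X^K.
Proof.
elim: K => [|K IH]; first by rewrite poly_def big_ord0 mulr0 !expr0 scale1r subrr.
rewrite !poly_def in IH *; rewrite big_ord_recr /= mulrDr IH mulrBl mul1r.
by rewrite -scalerAl -scalerAr scalerA -!exprS addrA subrK.
Qed.

(** Logarithmic derivative of [rootProd xs]: each factor contributes [- s / (1 - s 'X)], a geometric
    series, here truncated modulo ['X^K] and cleared of its denominator. *)
Lemma rootProd_psum K xs : 'X^K %| rootProd xs * psumPoly K xs + (rootProd xs)^`().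
Proof.
elim: xs => [|s xs IH].
  rewrite /rootProd big_nil mul1r derivC addr0 /psumPoly.
  suff -> : \poly_(r < K) psum [::] r.+1 = 0 by rewrite dvdp0.
  by apply/polyP=> i; rewrite coef_poly coef0 /psum big_nil if_same.
have -> : psumPoly K (s :: xs) = psumPoly K xs + \poly_(r < K) s ^+ r.+1.
  apply/polyP => i; rewrite coefD !coef_poly /psum big_cons.
  by case: ifP => _; rewrite ?addr0 // addrC.
have geo : (1 - s *: 'X) * \poly_(r < K) s ^+ r.+1 = s%:P - s ^+ K.+1 *: 'X^K.
  have -> : \poly_(r < K) s ^+ r.+1 = s *: \poly_(r < K) s ^+ r.
    apply/polyP => r; rewrite coefZ !coef_poly exprS.
    by case: ifP => _; rewrite ?mulr0.
  by rewrite -scalerAr geometric_poly scalerBr alg_polyC scalerA -exprS.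
rewrite /rootProd big_cons -/(rootProd xs) derivM.
have -> : (1 - s *: 'X)^`() = - s%:P.
  by rewrite derivB derivZ derivX derivC sub0r alg_polyC.
set a := rootProd xs in IH *; set T := \poly_(r < K) _ in geo *.
have -> : (1 - s *: 'X) * a * (psumPoly K xs + T) + (- s%:P * a + (1 - s *: 'X) * a^`())
  = (1 - s *: 'X) * (a * psumPoly K xs + a^`()) + a * ((1 - s *: 'X) * T - s%:P).
  ring.
rewrite geo dvdp_add ?dvdp_mull //.
by rewrite addrAC subrr add0r -scaleNr -mul_polyC dvdp_mull.
Qed.

(** [H] is [rootProd ys / rootProd xs] modulo ['X^K]. Its derivative is [H] times the difference of
    the two logarithmic derivatives, and the claim compares coefficients of degree [k].
    Differentiation costs one power of ['X], hence [K1]. *)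
Lemma newton K xs ys H : 'X^K %| rootProd xs * H - rootProd ys ->
  forall k, (k.+1 < K)%N ->
  k.+1%:R * H`_k.+1 = \sum_(r < k.+1) H`_r * (psum xs (k - r).+1 - psum ys (k - r).+1).
Proof.
move=> hH k hk; pose K1 := K.-1.
have hK : K = K1.+1 by rewrite /K1 prednK // (leq_ltn_trans _ hk).
set a := rootProd xs in hH; set b := rootProd ys in hH.
have d1 : 'X^K1 %| (a * H - b)^`().
  case/dvdpP: hH => e ->; rewrite derivM derivXn hK /= exprS.
  by rewrite dvdp_add ?dvdp_mull // -mulr_natl dvdp_mull.
have sub (p : {poly R}) : 'X^K %| p -> 'X^K1 %| p.
  by apply: dvdp_trans; rewrite hK exprS dvdp_mull.
have dx := sub _ (rootProd_psum K xs); have dy := sub _ (rootProd_psum K ys).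
rewrite -/a in dx; rewrite -/b in dy.
have dab := sub _ hH.
have : 'X^K1 %| a * (H^`() - H * (psumPoly K xs - psumPoly K ys)).
  have -> : a * (H^`() - H * (psumPoly K xs - psumPoly K ys)) =
     (a * H - b)^`() - H * (a * psumPoly K xs + a^`())
     + (a * H - b) * psumPoly K ys + (b * psumPoly K ys + b^`()).
    by rewrite derivB derivM; ring.
  apply: dvdp_add dy; apply: dvdp_add; last exact: dvdp_mulr.
  by apply: dvdp_sub => //; apply: dvdp_mull.
have a0 : a.[0] = 1.
  rewrite /a /rootProd horner_prod big1 // => s _.
  by rewrite hornerD hornerN hornerZ hornerX mulr0 subr0 hornerC.
(* The constant term of [a] is 1, so [a] is coprime to ['X] and can be cancelled. *)
rewrite Gauss_dvdpr; last first.
  apply: coprimep_expl; rewrite coprimep_sym -['X]subr0 -polyC0 coprimep_XsubC.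
  by rewrite rootE a0 oner_eq0.
case/dvdpP=> e /(congr1 (fun p : {poly R} => p`_k)).
rewrite coefMXn ifT; last by rewrite -ltnS -hK.
rewrite coefB coef_deriv => /eqP; rewrite subr_eq0 => /eqP e1.
rewrite mulr_natl e1 coefM; apply: eq_bigr => r _; rewrite coefB !coef_poly.
by rewrite ifT // (leq_ltn_trans (leq_subr _ _)) // ltnW.
Qed.


(** At [u != 0] a product of [1 - c *: 'X] is a power of [u] times a product of [u^-1 - c], to which
    [lagrange] applies at the point [u^-1]. *)
Lemma poly_eq_nonzero (p q : {poly R}) : (forall u, u != 0 -> p.[u] = q.[u]) -> p = q.
Proof.
move=> e; apply/eqP; rewrite -subr_eq0; apply/eqP.
pose rs : seq R := [seq i.+1%:R | i <- iota 0 (size (p - q))].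
apply: (@roots_geq_poly_eq0 _ _ rs).
- apply/allP => x /mapP[i _ ->]; rewrite rootE hornerD hornerN e ?subrr //.
- rewrite map_inj_uniq ?iota_uniq // => i j /eqP.
  by rewrite eqr_nat => /eqP[].
- by rewrite size_map size_iota.
Qed.

Lemma lagrange N (x : 'I_N -> R) (B : {poly R}) (z : R) :
  injective x -> (size B <= N)%N ->
  \sum_i B.[x i] / \prod_(j | j != i) (x i - x j) * \prod_(j | j != i) (z - x j) = B.[z].
Proof.
move=> xI sB.
pose L : {poly R} := \sum_i (B.[x i] / \prod_(j | j != i) (x i - x j))
   *: \prod_(j | j != i) ('X - (x j)%:P).
have evL t : L.[t] = \sum_i B.[x i] / \prod_(j | j != i) (x i - x j)
   * \prod_(j | j != i) (t - x j).
  rewrite horner_sum; apply: eq_bigr => i _; rewrite hornerZ horner_prod.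
  by congr (_ * _); apply: eq_bigr => j _; rewrite hornerXsubC.
rewrite -evL; congr (_.[z]); apply/eqP; rewrite -subr_eq0; apply/eqP.
apply: (@roots_geq_poly_eq0 _ _ [seq x i | i <- enum 'I_N]).
- apply/allP => _ /mapP[k _ ->]; rewrite rootE hornerD hornerN evL subr_eq0.
  rewrite (bigD1 k) //= [X in _ + X]big1 ?addr0 ?divfK //.
    by apply/prodf_neq0 => j jk; rewrite subr_eq0 inj_eq // eq_sym.
  by move=> i ik; rewrite [X in _ * X](bigD1 k) 1?eq_sym //= subrr mul0r mulr0.
- by rewrite map_inj_uniq ?enum_uniq.
- rewrite size_map size_enum_ord (leq_trans (size_polyD _ _)) // size_polyN geq_max sB andbT.
  apply: (leq_trans (size_sum _ _ _)); apply/bigmax_leqP => i _.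
  apply: (leq_trans (size_scale_leq _ _)).
  rewrite -(big_filter _ (fun j => j != i)) size_prod_XsubC.
  have -> : size [seq j <- index_enum 'I_N | j != i] = #|predC1 i|.
    by rewrite -sum1_size big_filter sum1_card.
  by rewrite cardC1 card_ord prednK // (leq_ltn_trans _ (ltn_ord i)).
Qed.


Variables (m : nat) (x : 'I_m.+1 -> R).
Hypothesis (xI : injective x).
Local Notation N := m.+1 (only parsing).
Let xs : seq R := [seq x i | i <- enum 'I_N].
Let ds : seq R := [seq x i - 1 | i <- enum 'I_N].

(* For x_i = la_i - i these are the probability of growing row i of la, and
   |la| times the probability of shrinking it. They vanish when the result is
   not a partition, so sums over i need no side condition. *)
Definition upWeight i : R :=
  (x i + N%:R)^-1 * \prod_(j | j != i) ((x i + 1 - x j) / (x i - x j)).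

Definition downWeight i : R :=
  (x i + N%:R - 1) * \prod_(j | j != i) ((x i - 1 - x j) / (x i - x j)).

Definition upMoment k : R := \sum_i upWeight i * x i ^+ k.

Definition downMoment k : R := \sum_i downWeight i * (x i - 1) ^+ k.

(** Coefficients of the logarithmic derivative of the fraction generating the up moments,
    denominator minus numerator; the entry [- N%:R] stands for the factor 1 + N u. *)
Definition psumDiff r : R := psum (- N%:R :: xs) r - psum ds r.

Lemma rootProd_xs : rootProd xs = \prod_i (1 - x i *: 'X).
Proof. by rewrite /rootProd big_map big_enum. Qed.

Lemma rootProd_ds : rootProd ds = \prod_i (1 - (x i - 1) *: 'X).
Proof. by rewrite /rootProd big_map big_enum. Qed.

Lemma horner_prod_recip (c : 'I_N -> R) (P : pred 'I_N) u : u != 0 ->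
  (\prod_(i | P i) (1 - c i *: 'X)).[u] = u ^+ #|P| * \prod_(i | P i) (u^-1 - c i).
Proof.
move=> u0; rewrite horner_prod -prodr_const -big_split /=.
by apply: eq_bigr => i _; rewrite hornerD hornerN hornerZ hornerX hornerC mulrBr divff // mulrC.
Qed.

(** Lagrange interpolation at the nodes [x i] of a polynomial of degree [m]. An empty last row gives
    [x ord_max - 1 = - N], so the factor [j = ord_max] of the numerator cancels 1 + N u and is
    absent from the right-hand side. *)
Lemma up_fraction : x ord_max = - m%:R -> (forall i, x i + N%:R != 0) ->
  \sum_i upWeight i *: \prod_(j | j != i) (1 - x j *: 'X)
  = \prod_(j | j != ord_max) (1 - (x j - 1) *: 'X).
Proof.
move=> xlast xN; apply: poly_eq_nonzero => u u0.
rewrite horner_prod_recip // horner_sum.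
pose B : {poly R} := \prod_(j | j != ord_max) ('X - (x j - 1)%:P).
have BE z : B.[z] = \prod_(j | j != ord_max) (z - (x j - 1)).
  by rewrite horner_prod; apply: eq_bigr => j _; rewrite hornerXsubC.
rewrite -BE -(@lagrange N x B) //; last first.
  rewrite /B -(big_filter _ (fun j => j != ord_max)) size_prod_XsubC.
  by rewrite -sum1_size big_filter sum1_card cardC1 card_ord.
rewrite mulr_sumr; apply: eq_bigr => i _.
rewrite hornerZ horner_prod_recip // !cardC1 mulrCA; congr (_ * (_ * _)).
rewrite /upWeight prodf_div BE mulrA; congr (_ / _).
(* The factor [x i + 1 - x i = 1] completes the product over all [j]; its factor at [ord_max] is
   [x i + N], which cancels the inverse in [upWeight]. *)
rewrite -[LHS]mulr1 -[X in _ * X = _](_ : x i + 1 - x i = 1); last by ring.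
rewrite -mulrA [X in _ * X](_ : _ = \prod_j (x i + 1 - x j)); last first.
  by rewrite [RHS](bigD1 i) //= mulrC.
rewrite (bigD1 ord_max) //= xlast opprK -addrA [1 + _]addrC -natr1 addrA.
rewrite mulKf; last by rewrite -addrA natr1.
by apply: eq_bigr => j _; ring.
Qed.

(** The right-hand side at [u] is [u ^+ N.+1 * B.[u^-1]]. The coefficients of [B] in degrees N + 1
    and N cancel, the second because the two families of roots have sums differing by N; so [B] is
    interpolated at the N nodes [x i - 1], and the two lost degrees are the factor ['X^2]. *)
Lemma down_fraction :
  \sum_i downWeight i *: \prod_(j | j != i) (1 - (x j - 1) *: 'X) * 'X^2
  = rootProd ds - rootProd (- N%:R :: xs).
Proof.
apply: poly_eq_nonzero => u u0.
have dI : injective (fun i => x i - 1) by move=> i j /addIr /xI.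
rewrite hornerD hornerN rootProd_ds /rootProd big_cons -/(rootProd xs) rootProd_xs.
rewrite hornerM !horner_prod_recip // horner_sum.
pose B : {poly R} := 'X * (\prod_j ('X - (x j - 1)%:P))
  - ('X + N%:R%:P) * \prod_j ('X - (x j)%:P).
have BE z : B.[z] = z * \prod_j (z - (x j - 1)) - (z + N%:R) * \prod_j (z - x j).
  rewrite hornerD hornerN !hornerM hornerD hornerX hornerC !horner_prod.
  by congr (_ * _ - _ * _); apply: eq_bigr => j _; rewrite hornerXsubC.
have top (c : 'I_N -> R) : let A := \prod_j ('X - (c j)%:P) in
    [/\ size A = N.+1, A`_N = 1 & A`_m = - \sum_j c j].
  have e : \prod_j ('X - (c j)%:P) = \prod_(p <- [seq c j | j <- enum 'I_N]) ('X - p%:P).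
    by rewrite big_map big_enum.
  have sz : size [seq c j | j <- enum 'I_N] = N by rewrite size_map size_enum_ord.
  rewrite /= e; split.
  - by rewrite size_prod_XsubC sz.
  - have /monicP := monic_prod_XsubC [seq c j | j <- enum 'I_N] predT id.
    by rewrite lead_coefE size_prod_XsubC sz.
  - have := @coefPn_prod_XsubC R [seq c j | j <- enum 'I_N].
    by rewrite sz => ->; rewrite // big_map big_enum.
have sB : (size B <= N)%N.
  apply/leq_sizeP => j Nj.
  have [sd dN dm] := top (fun i => x i - 1); have [sx xN xm] := top x.
  move: sd dN dm sx xN xm; rewrite /B.
  set D := \prod_j ('X - (x j - 1)%:P); set A := \prod_j ('X - (x j)%:P) => sd dN dm sx xN xm.
  rewrite mulrDl coefB coefD coefCM !coefXM.
  case: j Nj => // j; rewrite ltnS leq_eqVlt => /predU1P[<-|mj] /=.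
    rewrite dm xm xN sumrB sumr_const card_ord; ring.
  have -> : A`_j.+1 = 0 by rewrite nth_default // sx ltnS.
  move: mj; rewrite leq_eqVlt => /predU1P[<-|mj]; first by rewrite dN xN; ring.
  by rewrite !nth_default ?sx ?sd //; ring.
transitivity (u ^+ N.+1 * B.[u^-1]); last first.
  rewrite BE hornerD hornerN hornerZ hornerX hornerC cardT size_enum_ord exprS.
  by field.
rewrite -(@lagrange N (fun i => x i - 1) B) //.
rewrite mulr_sumr; apply: eq_bigr => i _.
rewrite hornerM hornerZ hornerXn horner_prod_recip // !cardC1 card_ord /=.
rewrite [RHS](_ : _ = u ^+ m * u ^+ 2 * (B.[x i - 1] / \prod_(j | j != i) (x i - 1 - (x j - 1)))
   * \prod_(j | j != i) (u^-1 - (x j - 1))); last first.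
  by rewrite -exprD addn2 -[RHS]mulrA.
suff -> : downWeight i = B.[x i - 1] / \prod_(j | j != i) (x i - 1 - (x j - 1)) by ring.
rewrite BE (bigD1 i) //= subrr mul0r mulr0 sub0r (bigD1 i) //=.
rewrite /downWeight prodf_div.
have -> : \prod_(j | j != i) (x i - 1 - (x j - 1)) = \prod_(j | j != i) (x i - x j).
  by apply: eq_bigr => j _; ring.
by ring.
Qed.

Lemma weighted_series K (w c : 'I_N -> R) :
  'X^K %| \prod_j (1 - c j *: 'X) * (\poly_(k < K) \sum_i w i * c i ^+ k)
    - \sum_i w i *: \prod_(j | j != i) (1 - c j *: 'X).
Proof.
have -> : \poly_(k < K) (\sum_i w i * c i ^+ k) = \sum_i w i *: \poly_(k < K) c i ^+ k.
  apply/polyP => k; rewrite coef_poly coef_sum.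
  under [RHS]eq_bigr => i _ do rewrite coefZ coef_poly.
  by case: ifP => // _; rewrite big1 // => i _; rewrite mulr0.
rewrite mulr_sumr -sumrB; apply: (big_ind (fun p => 'X^K %| p)) => [|p q|i _].
- exact: dvdp0.
- exact: dvdp_add.
rewrite (bigD1 i) //= -scalerAr -scalerBr mulrAC geometric_poly mulrBl mul1r addrAC subrr add0r.
by rewrite -!mul_polyC dvdp_mull // dvdpNr dvdp_mulr // dvdp_mull.
Qed.

Lemma upMoment_newton k : x ord_max = - m%:R -> (forall i, x i + N%:R != 0) ->
  k.+1%:R * upMoment k.+1 = \sum_(r < k.+1) upMoment r * psumDiff (k - r).+1.
Proof.
move=> xlast xN.
pose H : {poly R} := \poly_(j < k.+2) upMoment j.
have hH : 'X^(k.+2) %| rootProd (- N%:R :: xs) * H - rootProd ds.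
  have := weighted_series k.+2 upWeight x; rewrite up_fraction //.
  rewrite /rootProd big_cons -/(rootProd xs) -/(rootProd ds) rootProd_xs rootProd_ds.
  (* Multiplying by 1 + N u restores the factor [ord_max] that [up_fraction] had cancelled. *)
  move=> /(dvdp_mull (1 - - N%:R *: 'X)); rewrite mulrBr mulrA.
  rewrite [\prod_j (1 - (x j - 1) *: 'X)](bigD1 ord_max) //= xlast.
  by rewrite -opprD natr1.
have := newton hH (leqnn _).
rewrite coef_poly ltnSn => ->; apply: eq_bigr => r _.
by rewrite coef_poly (leq_trans (ltn_ord r)).
Qed.

(* Coefficients of 1 - u^2 \sum_k (downMoment k) u^k, the inverse of the series of upMoment. *)
Definition downCoef k : R := if k is j.+2 then - downMoment j else (k == 0)%:R.

Lemma downMoment_newton k :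
  k.+1%:R * downCoef k.+1 = - \sum_(r < k.+1) downCoef r * psumDiff (k - r).+1.
Proof.
pose H : {poly R} := \poly_(j < k.+2) downCoef j.
have HE : H = 1 - 'X^2 * \poly_(j < k) downMoment j.
  apply/polyP => j; rewrite coef_poly coefB coef1 coefXnM coef_poly.
  case: j => [|[|j]] /=; rewrite ?subr0 //.
  by rewrite !ltnS subn2 /= sub0r; case: ifP => _; rewrite ?oppr0.
have hH : 'X^(k.+2) %| rootProd ds * H - rootProd (- N%:R :: xs).
  have /(dvdp_mul (dvdpp 'X^2)) := weighted_series k downWeight (fun i => x i - 1).
  rewrite -exprD add2n -rootProd_ds mulrBr => h.
  rewrite HE mulrBr mulr1 addrAC -down_fraction -dvdpNr opprB.
  by move: h; rewrite mulrCA [X in _ - X]mulrC mulr_suml.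
have := newton hH (leqnn _).
rewrite coef_poly ltnSn => ->; rewrite -sumrN; apply: eq_bigr => r _.
by rewrite coef_poly (leq_trans (ltn_ord r)) // -mulrN opprB.
Qed.

End PowerSeries.

(** * Contents of a partition *)

Section Contents.
Variables (R : realFieldType) (m : nat).
Local Notation N := m.+1 (only parsing).
Implicit Types (la : 'I_N -> nat).

Definition shifted la (i : 'I_N) : R := (la i)%:R - (i : nat)%:R.

Definition boxSum la (f : R -> R) : R := \sum_(i < N) \sum_(j < la i) f (j%:R - i%:R).

Definition contentSum r la : R := boxSum la (fun c => c ^+ r).

Lemma eq_boxSum la f g : f =1 g -> boxSum la f = boxSum la g.
Proof. by move=> e; apply: eq_bigr => i _; apply: eq_bigr => j _; apply: e. Qed.

Lemma boxSumD la f g : boxSum la (fun c => f c + g c) = boxSum la f + boxSum la g.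
Proof. by rewrite -big_split; apply: eq_bigr => i _; rewrite -big_split. Qed.

Lemma boxSumZ la a f : boxSum la (fun c => a * f c) = a * boxSum la f.
Proof. by rewrite mulr_sumr; apply: eq_bigr => i _; rewrite mulr_sumr. Qed.

Definition nonincreasing la := [forall i : 'I_N, forall j : 'I_N, (i <= j)%N ==> (la j <= la i)%N].

Lemma nonincreasingP la :
  reflect (forall i j : 'I_N, (i <= j)%N -> (la j <= la i)%N) (nonincreasing la).
Proof.
apply: (iffP forallP) => [h i j ij|h i]; first by move/forallP/(_ j)/implyP: (h i); apply.
by apply/forallP => j; apply/implyP; apply: h.
Qed.

Lemma shifted_lt la (i j : 'I_N) : nonincreasing la -> (i < j)%N -> shifted la j < shifted la i.
Proof.
move=> /nonincreasingP h ij; rewrite /shifted ler_ltB ?ler_nat ?ltr_nat //.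
exact/h/ltnW.
Qed.

Lemma shifted_inj la : nonincreasing la -> injective (shifted la).
Proof.
move=> h i j e; apply/val_inj; case: (ltngtP i j) => // /(shifted_lt h).
  by rewrite e ltxx.
by rewrite e ltxx.
Qed.

Lemma shifted_gt la i : 0 < shifted la i + N%:R.
Proof. by rewrite /shifted addrAC subr_gt0 -natrD ltr_nat ltn_addl. Qed.

(** Along a row the second differences telescope to a first difference at the end of the row and one
    at its start; the latter telescope over the rows and leave the power of [- N]. *)
Lemma psumDiff_contents la r : psumDiff (shifted la) r.+1 =
  boxSum la (fun c => (c + 1) ^+ r.+1 - c ^+ r.+1 *+ 2 + (c - 1) ^+ r.+1).
Proof.
rewrite /boxSum.
have row (i : 'I_N) a : \sum_(j < a) ((j%:R - i%:R + 1) ^+ r.+1 - (j%:R - i%:R) ^+ r.+1 *+ 2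
     + (j%:R - i%:R - 1) ^+ r.+1)
  = (a%:R - i%:R) ^+ r.+1 - (a%:R - i%:R - 1) ^+ r.+1
    + ((- i.+1%:R) ^+ r.+1 - (- i%:R) ^+ r.+1) :> R.
  elim: a => [|a IH].
    by rewrite big_ord0 sub0r -natr1 opprD; ring.
  by rewrite big_ord_recr /= IH -!natr1 [a%:R + 1 - _]addrAC addrK; ring.
under eq_bigr => i _ do rewrite row.
rewrite big_split /= -(big_mkord predT (fun i => (- i.+1%:R) ^+ r.+1 - (- i%:R) ^+ r.+1)).
rewrite telescope_sumr // oppr0 expr0n subr0 sumrB.
by rewrite /psumDiff /psum big_cons big_map [X in _ - X]big_map !big_enum /= addrC addrA addrAC.
Qed.

Lemma contentSum0 la : contentSum 0 la = (\sum_i la i)%:R.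
Proof. by rewrite natr_sum; apply: eq_bigr => i _; rewrite sumr_const card_ord. Qed.

Lemma psumDiff_small la (S := contentSum ^~ la) :
  ([/\ psumDiff (shifted la) 1 = 0, psumDiff (shifted la) 2 = 2 * S 0%N &
      psumDiff (shifted la) 3 = 6 * S 1%N] /\
   [/\ psumDiff (shifted la) 4 = 12 * S 2%N + 2 * S 0%N,
      psumDiff (shifted la) 5 = 20 * S 3%N + 10 * S 1%N &
      psumDiff (shifted la) 6 = 30 * S 4%N + 30 * S 2%N + 2 * S 0%N]).
Proof.
rewrite /S !psumDiff_contents /contentSum -!boxSumZ -!boxSumD; do 2!split.
  rewrite -[RHS](mul0r (boxSum la (fun=> 0))) -boxSumZ.
all: by apply: eq_boxSum => c; ring.
Qed.

Section Moments.
Variable la : 'I_N -> nat.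
Hypothesis laP : nonincreasing la.
Let S := contentSum ^~ la.
Let x := shifted la.

Let xI : injective x. Proof. exact: shifted_inj. Qed.
Let P1 : psumDiff x 1 = 0. Proof. by case: (psumDiff_small la) => -[]. Qed.
Let P2 : psumDiff x 2 = 2 * S 0%N. Proof. by case: (psumDiff_small la) => -[]. Qed.
Let P3 : psumDiff x 3 = 6 * S 1%N. Proof. by case: (psumDiff_small la) => -[]. Qed.
Let P4 : psumDiff x 4 = 12 * S 2%N + 2 * S 0%N.
Proof. by case: (psumDiff_small la) => _ []. Qed.
Let P5 : psumDiff x 5 = 20 * S 3%N + 10 * S 1%N.
Proof. by case: (psumDiff_small la) => _ []. Qed.
Let P6 : psumDiff x 6 = 30 * S 4%N + 30 * S 2%N + 2 * S 0%N.
Proof. by case: (psumDiff_small la) => _ []. Qed.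

Lemma downMoments :
  [/\ downMoment x 0 = S 0%N, downMoment x 1 = 2 * S 1%N,
    downMoment x 2 = 3 * S 2%N + (S 0%N - S 0%N ^+ 2) / 2 &
    downMoment x 3 = 4 * S 3%N + 2 * S 1%N - 2 * S 0%N * S 1%N].
Proof.
have n1 := downMoment_newton xI 1; have n2 := downMoment_newton xI 2.
have n3 := downMoment_newton xI 3; have n4 := downMoment_newton xI 4.
rewrite !big_ord_recl !big_ord0 /= /bump /= ?subn0 ?add1n ?addn0 ?subSS ?subn0 in n1 n2 n3 n4.
rewrite P1 P2 in n1; rewrite P1 P2 P3 in n2; rewrite P1 P2 P3 P4 in n3.
rewrite P1 P2 P3 P4 P5 in n4.
have d0 : downMoment x 0 = S 0%N by lra.
have d1 : downMoment x 1 = 2 * S 1%N by rewrite d0 in n2; lra.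
have d2 : downMoment x 2 = 3 * S 2%N + (S 0%N - S 0%N ^+ 2) / 2 by rewrite d0 d1 in n3; lra.
split => //; rewrite d0 d1 d2 in n4; lra.
Qed.

Hypothesis la_last : la ord_max = 0%N.

Lemma upMoments :
  [/\ upMoment x 0 = 1, upMoment x 1 = 0, upMoment x 2 = S 0%N,
    upMoment x 3 = 2 * S 1%N &
    upMoment x 4 = 3 * S 2%N + (S 0%N + S 0%N ^+ 2) / 2 /\
    upMoment x 6 = 5 * S 4%N + 5 * S 2%N + S 0%N / 3 + 3 * S 0%N * S 2%N
      + 2 * S 1%N ^+ 2 + S 0%N ^+ 2 / 2 + S 0%N ^+ 3 / 6].
Proof.
have xlast : x ord_max = - m%:R by rewrite /x /shifted la_last sub0r.
have xN i : x i + N%:R != 0 by rewrite gt_eqF // shifted_gt.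
have u0 : upMoment x 0 = 1.
  have := up_fraction xI xlast xN => /(congr1 (fun p : {poly R} => p.[0])).
  have h0 (P : pred 'I_N) (c : 'I_N -> R) : (\prod_(j | P j) (1 - c j *: 'X)).[0] = 1.
    rewrite horner_prod big1 // => j _.
    by rewrite hornerD hornerN hornerZ hornerX hornerC mulr0 subr0.
  rewrite h0 horner_sum => <-; apply: eq_bigr => i _.
  by rewrite hornerZ h0 expr0.
have nw k := upMoment_newton xI k xlast xN.
have n1 := nw 0; have n2 := nw 1; have n3 := nw 2; have n4 := nw 3; have n5 := nw 4; have n6 := nw 5.
rewrite !big_ord_recl !big_ord0 /= /bump /= ?subn0 ?add1n ?addn0 ?subSS ?subn0 in n1 n2 n3 n4 n5 n6.
rewrite P1 in n1; rewrite P1 P2 in n2; rewrite P1 P2 P3 in n3.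
rewrite P1 P2 P3 P4 in n4; rewrite P1 P2 P3 P4 P5 P6 in n6.
have u1 : upMoment x 1 = 0 by lra.
have u2 : upMoment x 2 = S 0%N by rewrite u0 u1 in n2; lra.
have u3 : upMoment x 3 = 2 * S 1%N by rewrite u0 u1 u2 in n3; lra.
have u4 : upMoment x 4 = 3 * S 2%N + (S 0%N + S 0%N ^+ 2) / 2.
  by rewrite u0 u1 u2 u3 in n4; lra.
split=> //; split=> //; rewrite u0 u1 u2 u3 u4 in n6; nra.
Qed.

End Moments.
End Contents.

(** * Hook products *)

Section Hook.
Local Open Scope nat_scope.

Lemma colLen_max (s : seq nat) y j : all (geq^~ y) s -> j < y -> colLen s j = size s.
Proof.
move=> /allP h jy; apply/eqP; rewrite -all_count; apply/allP => a /h /= ya.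
exact: leq_trans jy ya.
Qed.

(** The hooks of the first row and the differences of its beta number with the others fill up 1,
    ..., [x + size s]. Induction on the last row [y]: it lengthens exactly the columns [j < y],
    which were full, and there the product telescopes ([tele]). *)
Lemma hook_first_row (s : seq nat) x : sorted geq (x :: s) ->
  (\prod_(j < x) (x - j + colLen s j)) * \prod_(k < size s) (x - nth 0 s k + k.+1)
  = (x + size s)`!.
Proof.
elim/last_ind: s => [|s y IH] srt.
  rewrite big_ord0 muln1 addn0 -ffactnn ffact_prod; apply: eq_bigr => j _.
  by rewrite /colLen /= addn0.
have tr : transitive geq by move=> a b c ab bc; apply: leq_trans bc ab.
move: (srt); rewrite /= rcons_path => /andP[srt1 ylast].
have yle : all (geq^~ y) (x :: s).
  have := srt; rewrite sorted_pairwise // -rcons_cons pairwise_rcons => /andP[+ _].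
  by apply: sub_all.
have yx : y <= x by case/andP: yle.
have cl j : colLen (rcons s y) j = colLen s j + (j < y) by rewrite /colLen -cats1 count_cat /= addn0.
have tele : \prod_(j < y) (x - j + (size s).+1) * (x - y + (size s).+1)
    = (x + (size s).+1) * \prod_(j < y) (x - j + size s).
  transitivity (\prod_(j < y.+1) (x - j + (size s).+1)); first by rewrite big_ord_recr.
  rewrite big_ord_recl subn0; congr (_ * _); apply: eq_bigr => j _.
  by rewrite /= /bump /=; have := ltn_ord j; lia.
have key : \prod_(j < x) (x - j + colLen (rcons s y) j) * (x - y + (size s).+1)
    = (x + (size s).+1) * \prod_(j < x) (x - j + colLen s j).
  have mk (f : nat -> nat) n : \prod_(j < n) f j = \prod_(0 <= j < n) f j by rewrite big_mkord.
  rewrite !(mk (fun j => x - j + _)) in tele.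
  rewrite (mk (fun j => x - j + colLen _ j)) (mk (fun j => x - j + colLen s j)).
  rewrite !(big_cat_nat (leq0n y) yx) /= mulnA.
  have -> : \prod_(0 <= j < y) (x - j + colLen (rcons s y) j)
      = \prod_(0 <= j < y) (x - j + (size s).+1).
    apply: eq_big_nat => j /andP[_ jy]; rewrite cl jy addn1 (@colLen_max s y) //.
    by case/andP: yle.
  have -> : \prod_(0 <= j < y) (x - j + colLen s j) = \prod_(0 <= j < y) (x - j + size s).
    apply: eq_big_nat => j /andP[_ jy]; rewrite (@colLen_max s y) //.
    by case/andP: yle.
  have -> : \prod_(y <= j < x) (x - j + colLen (rcons s y) j)
      = \prod_(y <= j < x) (x - j + colLen s j).
    by apply: eq_big_nat => j /andP[yj _]; rewrite cl ltnNge yj addn0.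
  by rewrite mulnAC tele.
rewrite size_rcons addnS factS -addnS -IH // big_ord_recr /=.
rewrite nth_rcons ltnn eqxx mulnA -[LHS]mulnAC key mulnA; congr (_ * _).
by apply: eq_bigr => k _; rewrite nth_rcons ltn_ord.
Qed.

(** Deleting the first row does not change the hooks of the other rows, so [hook_first_row] supplies
    one factorial at each step of the induction. *)
Lemma hookProd_vandermonde (s : seq nat) : sorted geq s ->
  hookProd s * \prod_(i < size s) \prod_(j < size s | i < j) (nth 0 s i - nth 0 s j + (j - i))
  = \prod_(i < size s) (nth 0 s i + (size s - i.+1))`!.
Proof.
elim: s => [|x s IH] srt; first by rewrite /hookProd !big_ord0.
have srts : sorted geq s by apply: path_sorted srt.
have tr : transitive geq by move=> a b c ab bc; apply: leq_trans bc ab.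
have sx : all (geq x) s by move: srt; rewrite /= path_sortedE // => /andP[].
have hook_succ (i : 'I_(size s)) (j : 'I_(nth 0 s i)) : hook (x :: s) i.+1 j = hook s i j.
  have jx : j < x.
    by apply: leq_trans (ltn_ord j) _; move/all_nthP: sx => /(_ 0 i (ltn_ord i)).
  by rewrite /hook /colLen /= jx; lia.
have -> : hookProd (x :: s) = (\prod_(j < x) (x - j + colLen s j)) * hookProd s.
  rewrite /hookProd /= big_ord_recl; congr (_ * _).
    by apply: eq_bigr => j _; rewrite /hook /colLen /= ltn_ord; lia.
  by apply: eq_bigr => i _ /=; apply: eq_bigr => j _; rewrite hook_succ.
rewrite /= !big_ord_recl /= subSS subn0 -(hook_first_row srt).
rewrite [X in _ * (X * _)](_ : _ = \prod_(k < size s) (x - nth 0 s k + k.+1)); last first.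
  by rewrite big_mkcond big_ord_recl /= mul1n; apply: eq_bigr => k _; rewrite subn0.
rewrite mulnACA. congr muln; rewrite -[RHS]IH //; congr muln.
apply: eq_bigr => i _; rewrite big_mkcond big_ord_recl /= mul1n -big_mkcond.
by apply: eq_bigr => j _; rewrite /bump /= subSS.
Qed.
End Hook.

(** * Plancherel growth *)

Section Growth.
Variables (R : realFieldType) (m : nat).
Local Notation N := m.+1 (only parsing).
Implicit Types (la : 'I_N -> nat) (i j : 'I_N) (k : nat).
Notation x la := (shifted R la).

Definition isPart k la := nonincreasing la && (\sum_i la i == k)%N.

Definition addBox la i : 'I_N -> nat := fun j => (la j + (j == i))%N.

Definition remBox la i : 'I_N -> nat := fun j => (la j - (j == i))%N.

(* x_i - x_j is also the difference of the beta numbers la_i + m - i, hence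
   vand la / factProd la = 1 / hookProd la. *)
Definition vand la : R := \prod_(i < N) \prod_(j < N | (i < j)%N) (x la i - x la j).

Definition factProd la : R := \prod_(i < N) ((la i + (m - i))`!)%:R.

Definition planch k la : R := k`!%:R * (vand la / factProd la) ^+ 2.

Lemma vand_gt0 la : nonincreasing la -> 0 < vand la.
Proof.
move=> h; apply: prodr_gt0 => i _; apply: prodr_gt0 => j ij.
by rewrite subr_gt0; apply: shifted_lt.
Qed.

Lemma factProd_gt0 la : 0 < factProd la.
Proof. by apply: prodr_gt0 => i _; rewrite ltr0n fact_gt0. Qed.

Lemma planch_ge0 k la : 0 <= planch k la.
Proof. by rewrite mulr_ge0 ?sqr_ge0. Qed.

Lemma shifted_addBox la i j : x (addBox la i) j = x la j + (j == i)%:R.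
Proof. by rewrite /shifted natrD addrAC. Qed.

Lemma shifted_neq la i j : nonincreasing la -> j != i -> x la i - x la j != 0.
Proof. by move=> h ji; rewrite subr_eq0 (inj_eq (shifted_inj h)) eq_sym. Qed.

Lemma vand_addBox la i : nonincreasing la ->
  vand (addBox la i) = vand la * \prod_(j | j != i) ((x la i + 1 - x la j) / (x la i - x la j)).
Proof.
move=> h; pose r a b := (x (addBox la i) a - x (addBox la i) b) / (x la a - x la b).
have -> : vand (addBox la i) = vand la * \prod_(a < N) \prod_(b < N | (a < b)%N) r a b.
  rewrite -big_split /=; apply: eq_bigr => a _; rewrite -big_split /=.
  apply: eq_bigr => b ab; rewrite mulrC divfK // shifted_neq //.
  by rewrite -val_eqE /= gtn_eqF.
congr (_ * _).
pose q j := (x la i + 1 - x la j) / (x la i - x la j).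
(* Only pairs containing [i] change. When [i] is the second index, numerator and denominator both
   change sign, so the ratio is again a value of [q]. *)
have rE a b : r a b = if a == i then (if b == i then r i i else q b)
                      else if b == i then q a else (x la a - x la b) / (x la a - x la b).
  rewrite /r /q !shifted_addBox; case: (altP (a =P i)) => [->|ai]; case: (altP (b =P i)) => [->|bi];
    rewrite ?mulr1n ?mulr0n ?addr0 //.
  - by rewrite eqxx.
  - by rewrite -opprB -[X in _ / X]opprB invrN mulrNN.
transitivity (\prod_(b < N | (i < b)%N) q b * \prod_(a < N | a != i) if (a < i)%N then q a else 1).
  rewrite (bigD1 i) //=; congr (_ * _).
    by apply: eq_bigr => b ib; rewrite rE eqxx ifN // -val_eqE /= gtn_eqF.
  apply: eq_bigr => a ai; case: ifP => [lt_ai|].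
    rewrite (bigD1 i) //= big1 ?mulr1; first by rewrite rE (negbTE ai) eqxx.
    move=> b /andP[ab bi]; rewrite rE (negbTE ai) (negbTE bi) divff //.
    by rewrite shifted_neq // -val_eqE /= gtn_eqF.
  move=> nai; apply: big1 => b ab; rewrite rE (negbTE ai) ifN ?divff //.
    by rewrite shifted_neq // -val_eqE /= gtn_eqF.
  by apply: contraFN nai => /eqP <-.
rewrite -big_mkcondr /= mulrC [RHS](bigID (fun j : 'I_N => (j < i)%N)) /=; congr (_ * _).
by apply: eq_bigl => b; rewrite -leqNgt -val_eqE /= ltn_neqAle eq_sym.
Qed.

Lemma factProd_addBox la i : factProd (addBox la i) = factProd la * (x la i + N%:R).
Proof.
rewrite /factProd (bigD1 i) //= [in RHS](bigD1 i) //= mulrAC; congr (_ * _).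
  rewrite /addBox eqxx addn1 addSn factS natrM mulrC; congr (_ * _).
  have e : ((la i + (m - i)).+1 + i = la i + m.+1)%N by rewrite addSn -addnA subnK ?leq_ord // addnS.
  by apply: (addIr (i : nat)%:R); rewrite /shifted addrAC subrK -!natrD e.
by apply: eq_bigr => j ji; rewrite /addBox (negbTE ji) addn0.
Qed.

Lemma shifted_pos_neq0 la i : x la i + N%:R != 0.
Proof. by rewrite gt_eqF // shifted_gt. Qed.

(** Detailed balance. A box in row [i] multiplies [vand] by [r] and [factProd] by [X = x la i + N];
    the up weight is [r / X], and the down weight at the larger shape is [X / r]. *)
Lemma planch_balance k la i : nonincreasing la -> nonincreasing (addBox la i) ->
  planch k la * upWeight (x la) i
  = planch k.+1 (addBox la i) * (downWeight (x (addBox la i)) i / k.+1%:R).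
Proof.
move=> h h'; rewrite /planch /upWeight /downWeight.
rewrite vand_addBox // factProd_addBox.
set r := \prod_(j | j != i) _.
have -> : \prod_(j | j != i) ((x (addBox la i) i - 1 - x (addBox la i) j)
    / (x (addBox la i) i - x (addBox la i) j)) = r^-1.
  rewrite -prodfV; apply: eq_bigr => j ji; rewrite !shifted_addBox eqxx (negbTE ji) addrK addr0.
  by rewrite invf_div.
have r0 : r != 0.
  have := vand_gt0 h'; rewrite vand_addBox //.
  by apply: contraTneq; rewrite -/r => ->; rewrite mulr0 ltxx.
have xN := shifted_pos_neq0 la i; have f0 := lt0r_neq0 (factProd_gt0 la).
rewrite shifted_addBox eqxx factS natrM.
have k0 : k.+1%:R != 0 :> R by rewrite pnatr_eq0.
have -> : x la i + true%:R + N%:R - 1 = x la i + N%:R by rewrite /=; ring.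
by move: k.+1%:R k0 (_ + _) xN => c k0 X xN; field; rewrite f0 k0 r0 xN.
Qed.

(** The order can fail only if row [i.-1] is as long as row [i]; then [x la i + 1 - x la j = 0] for
    [j = i.-1]. *)
Lemma upWeight_eq0 la i : nonincreasing la -> ~~ nonincreasing (addBox la i) ->
  upWeight (x la) i = 0.
Proof.
move=> /nonincreasingP h; rewrite negb_forall => /existsP[a].
rewrite negb_forall => /existsP[b]; rewrite negb_imply -ltnNge /addBox => /andP[ab].
have := h _ _ ab.
have [bi | bi] := altP (b =P i); last by rewrite addn0; lia.
rewrite bi in ab *; have [-> | ai] := altP (a =P i); first by lia.
move=> le1 lt1; have {}ai : (a < i)%N by rewrite ltn_neqAle ai.
have i0 : (i.-1 < N)%N by rewrite (leq_ltn_trans (leq_pred _)).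
pose j := Ordinal i0.
have ji : j != i by rewrite -val_eqE /=; lia.
have eqj : la j = la i.
  have := h j i (leq_pred _); have : (a <= j)%N by rewrite /=; lia.
  move/h; lia.
rewrite /upWeight (bigD1 j) //= /shifted eqj /=.
have -> : (i : nat)%:R = i.-1%:R + 1 :> R by rewrite natr1 prednK //; lia.
by rewrite [X in X / _](_ : _ = 0) ?mul0r ?mulr0 //; ring.
Qed.

Lemma upWeight_ge0 la i : nonincreasing la -> 0 <= upWeight (x la) i.
Proof.
move=> h; have [h'|h'] := boolP (nonincreasing (addBox la i)); last by rewrite upWeight_eq0.
rewrite mulr_ge0 ?invr_ge0 ?ltW ?shifted_gt //.
by have := vand_gt0 h'; rewrite vand_addBox // pmulr_rgt0 ?vand_gt0 // => /ltW.
Qed.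

(** Either the next row is equally long, which annihilates the factor [x la i - 1 - x la j], or [i]
    is the last row and is empty, which annihilates [x la i + N - 1]. *)
Lemma downWeight_eq0 la i : nonincreasing la -> ~~ ((0 < la i)%N && nonincreasing (remBox la i)) ->
  downWeight (x la) i = 0.
Proof.
move=> /nonincreasingP h hn.
suff : (i == m :> nat) && (la i == 0)%N \/ exists2 j : 'I_N, j = i.+1 :> nat & la j = la i.
  case=> [/andP[/eqP im /eqP li0]|[j ji lj]].
    by rewrite /downWeight /shifted li0 im [X in X * _](_ : _ = 0) ?mul0r // -natr1; ring.
  rewrite /downWeight (bigD1 j) /=; last by rewrite -val_eqE /= ji; lia.
  by rewrite /shifted lj ji -natr1 [X in X / _](_ : _ = 0) ?mul0r ?mulr0 //; ring.
have nxt : (i < m)%N -> exists2 j : 'I_N, j = i.+1 :> nat & (la j <= la i)%N.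
  by move=> im; exists (Ordinal (im : (i.+1 < N)%N)) => //; apply: h; rewrite /=.
have [li0|li0] := posnP (la i).
  have [im|im] := eqVneq (i : nat) m; [by left|right].
  have /nxt[j ji lj] : (i < m)%N by rewrite ltn_neqAle im leq_ord.
  by exists j => //; lia.
right; move: hn; rewrite li0 /= negb_forall => /existsP[a].
rewrite negb_forall => /existsP[b]; rewrite negb_imply -ltnNge /remBox => /andP[ab].
have := h _ _ ab.
have [ai | ai] := altP (a =P i); last by lia.
have [bi | bi] := altP (b =P i); first by rewrite ai bi; lia.
rewrite ai in ab * => le1 lt1.
have ib : (i < b)%N by rewrite ltn_neqAle ab andbT eq_sym.
have /nxt[j ji lj] : (i < m)%N by have := ltn_ord b; lia.
by exists j => //; have := h j b; rewrite ji => /(_ ib); lia.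
Qed.


Let T := N.-tuple 'I_N.+1.

Definition rowFun (t : T) : 'I_N -> nat := fun i => tnth t i.

Definition tupleOf la : T := [tuple inord (la i) | i < N].

Lemma tupleOfK la : (forall i, la i <= N)%N -> rowFun (tupleOf la) = la.
Proof. by move=> h; apply/funext => i; rewrite /rowFun tnth_mktuple inordK ?ltnS. Qed.

Lemma rowFunK t : tupleOf (rowFun t) = t.
Proof. by apply: eq_from_tnth => i; rewrite tnth_mktuple /rowFun inord_val. Qed.

Lemma addBoxK la i : remBox (addBox la i) i = la.
Proof. by apply/funext => j; rewrite /remBox /addBox addnK. Qed.

Lemma remBoxK la i : (0 < la i)%N -> addBox (remBox la i) i = la.
Proof.
by move=> h; apply/funext => j; rewrite /remBox /addBox; case: eqP => [->|_]; rewrite ?subn0 ?addn0 ?subnK.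
Qed.

Lemma sum_addBox la i : (\sum_j addBox la i j = (\sum_j la j).+1)%N.
Proof.
rewrite big_split /= -[RHS]addn1; congr addn.
by rewrite (bigD1 i) //= eqxx big1 // => j /negbTE ->.
Qed.

Lemma isPart_le k la : isPart k la -> forall i, (la i <= k)%N.
Proof. by case/andP => _ /eqP <- i; rewrite (bigD1 i) //= leq_addr. Qed.

Lemma isPart_last k la : isPart k la -> (k <= m)%N -> la ord_max = 0%N.
Proof.
case/andP => /nonincreasingP h /eqP <-; case: (posnP (la ord_max)) => // l0.
have : (\sum_(i < N) 1 <= \sum_i la i)%N.
  by apply: leq_sum => i _; apply: leq_trans l0 _; apply: h; apply: leq_ord.
by rewrite sum1_card card_ord ltnNge => /negbTE ->.
Qed.

(** The index type is the same for every [k], so growth from [k] to [k.+1] is a reindexing inside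
    one type; for [k <= N] every partition of [k] occurs in it. *)
Definition expect k (f : ('I_N -> nat) -> R) : R :=
  \sum_(t : T | isPart k (rowFun t)) planch k (rowFun t) * f (rowFun t).

Lemma eq_expect k f g : (forall la, isPart k la -> f la = g la) -> expect k f = expect k g.
Proof. by move=> h; apply: eq_bigr => t /h ->. Qed.

Definition upMean la (g : 'I_N -> R) : R := \sum_i upWeight (x la) i * g i.

Definition downMean k la (g : 'I_N -> R) : R := \sum_i downWeight (x la) i / k%:R * g i.

(** Sum of [planch_balance] over all pairs of a shape and a row. Terms of zero weight are discarded
    on both sides; on the rest, adding ([U]) and removing ([D]) a box in row [i] are inverse
    bijections. *)
Lemma expect_balance k (H : ('I_N -> nat) -> 'I_N -> R) : (k <= m)%N ->
  expect k (fun la => upMean la (H la)) =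
  expect k.+1 (fun la => downMean k.+1 la (fun i => H (remBox la i) i)).
Proof.
move=> km; rewrite /expect /upMean /downMean.
under eq_bigr => t _ do rewrite mulr_sumr.
under [RHS]eq_bigr => t _ do rewrite mulr_sumr.
rewrite exchange_big [RHS]exchange_big /=; apply: eq_bigr => i _.
pose U t := tupleOf (addBox (rowFun t) i); pose D t := tupleOf (remBox (rowFun t) i).
have Dk t : rowFun (D t) = remBox (rowFun t) i.
  by rewrite tupleOfK // => j; rewrite /remBox (leq_trans (leq_subr _ _)) // -ltnS ltn_ord.
have Uk t : isPart k (rowFun t) -> rowFun (U t) = addBox (rowFun t) i.
  move=> /isPart_le h; rewrite tupleOfK // => j.
  by rewrite /addBox -[leqRHS]addn1 leq_add ?leq_b1 // (leq_trans (h j)).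
rewrite (bigID (fun t => nonincreasing (addBox (rowFun t) i))) /= [X in _ + X]big1 ?addr0; last first.
  by move=> t /andP[/andP[h _] h']; rewrite upWeight_eq0 // mul0r mulr0.
rewrite [RHS](bigID (fun t => (0 < rowFun t i)%N && nonincreasing (remBox (rowFun t) i))) /=.
rewrite [X in _ = _ + X]big1 ?addr0; last first.
  by move=> t /andP[/andP[h _] h']; rewrite downWeight_eq0 // !mul0r mulr0.
rewrite (reindex_onto D U) /=; last first.
  move=> t /andP[h _]; apply: (can_inj rowFunK); rewrite Dk Uk // addBoxK //.
apply: eq_big => [t|t /andP[/andP[hk ha] /eqP UD]].
  rewrite Dk; apply/idP/idP => [/andP[/andP[hk ha] /eqP UD]|].
    have e : rowFun t = addBox (remBox (rowFun t) i) i by rewrite -{1}UD Uk Dk.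
    have t0 : (0 < rowFun t i)%N by rewrite e /addBox eqxx addn1.
    rewrite t0 /=; move: (hk) => /andP[-> /eqP sk]; rewrite andbT /isPart.
    by rewrite {1}e ha e sum_addBox sk /=.
  case/andP => /andP[h /eqP sk] /andP[t0 h'].
  have e := remBoxK t0.
  have hk : isPart k (remBox (rowFun t) i).
    by rewrite /isPart h'; move: sk; rewrite -{1}e sum_addBox => -[->] /=.
  by rewrite hk e h /=; apply/eqP/(can_inj rowFunK); rewrite Uk Dk ?e.
have e : rowFun t = addBox (rowFun (D t)) i by rewrite -{1}UD Uk.
rewrite mulrA planch_balance; last 2 first.
- by case/andP: hk.
- by [].
by rewrite -!mulrA -e Dk.
Qed.

Lemma expect_succ k f : (k <= m)%N ->
  expect k.+1 f = expect k (fun la => upMean la (fun i => f (addBox la i))).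
Proof.
move=> km; rewrite expect_balance //; apply: eq_expect => la /andP[h /eqP sk].
have [d0 _ _ _] := downMoments R h.
(* In an empty row, removing and adding back a box is not the identity, because subtraction
   truncates at 0; the weight vanishes there. *)
have e i : downWeight (x la) i / k.+1%:R * f (addBox (remBox la i) i)
    = downWeight (x la) i / k.+1%:R * f la.
  have [i0|i0] := posnP (la i); last by rewrite remBoxK.
  by rewrite downWeight_eq0 ?i0 // !mul0r.
rewrite /downMean; under eq_bigr => i _ do rewrite e.
rewrite -!mulr_suml.
have -> : \sum_i downWeight (x la) i = k.+1%:R.
  rewrite -sk -(contentSum0 R) -d0 /downMoment.
  by apply: eq_bigr => i _; rewrite expr0 mulr1.
by rewrite divff ?mul1r // pnatr_eq0.
Qed.

End Growth.

(** * Moments of content power sums *)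

Section PlancherelMoments.
Variables (R : realType) (m : nat).
Local Notation N := m.+1 (only parsing).
Implicit Types (la : 'I_N -> nat) (i j : 'I_N) (k : nat).
Notation x la := (shifted R la).
Notation S r la := (contentSum R r la).

Lemma sorted_of_nonincreasing la (s : seq nat) : size s = N -> (forall i, nth 0%N s i = la i) ->
  nonincreasing la -> sorted geq s.
Proof.
move=> sz hs /nonincreasingP h; apply/(sortedP 0%N) => i; rewrite sz => iN.
have iN' := ltnW iN; rewrite (hs (Ordinal iN')) (hs (Ordinal iN)).
by apply: h => /=.
Qed.

Lemma vand_hook la (s : seq nat) : size s = N -> (forall i, nth 0%N s i = la i) ->
  nonincreasing la -> vand R la * (hookProd s)%:R = factProd R la.
Proof.
move=> sz hs hla; have srt := sorted_of_nonincreasing sz hs hla.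
have /nonincreasingP h := hla.
have /(congr1 (fun n => n%:R : R)) := hookProd_vandermonde srt.
rewrite natrM mulrC sz !natr_prod => e.
have -> : vand R la = \prod_(i < N) (\prod_(j < N | (i < j)%N)
    (nth 0 s i - nth 0 s j + (j - i))%N)%:R.
  apply: eq_bigr => i _; rewrite natr_prod; apply: eq_bigr => j ij.
  by rewrite !hs natrD (natrB _ (h _ _ (ltnW ij))) (natrB _ (ltnW ij)) /shifted; ring.
rewrite e; apply: eq_bigr => i _; rewrite hs.
by rewrite subSS.
Qed.

Lemma plancherel_planch k la (s : seq nat) : size s = N -> (forall i, nth 0%N s i = la i) ->
  nonincreasing la -> plancherel k s = planch R k la.
Proof.
move=> sz hs h; have e := vand_hook sz hs h.
have V0 := lt0r_neq0 (vand_gt0 R h); have F0 := lt0r_neq0 (factProd_gt0 R la).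
have H0 : (hookProd s)%:R != 0 :> R by apply: contraNneq F0 => H0; rewrite -e H0 mulr0.
by rewrite /plancherel /planch -e natrX; field; rewrite H0 V0.
Qed.

Lemma expectD k (f g : ('I_N -> nat) -> R) :
  expect k (fun la => f la + g la) = expect k f + expect k g.
Proof. by rewrite -big_split; apply: eq_bigr => t _; rewrite mulrDr. Qed.

Lemma expectZ k a (f : ('I_N -> nat) -> R) : expect k (fun la => a * f la) = a * expect k f.
Proof. by rewrite mulr_sumr; apply: eq_bigr => t _; rewrite mulrCA. Qed.

Lemma expect_le k (f g : ('I_N -> nat) -> R) :
  (forall la, isPart k la -> f la <= g la) -> expect k f <= expect k g.
Proof. by move=> h; apply: ler_sum => t /h fg; rewrite ler_wpM2l // planch_ge0. Qed.

Lemma expect0 (f : ('I_N -> nat) -> R) : expect 0 f = f (fun=> 0%N).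
Proof.
pose z := fun _ : 'I_N => 0%N.
have zP : isPart 0 z by rewrite /isPart big1 // eqxx andbT; apply/nonincreasingP.
have zr : rowFun (tupleOf z) = z by rewrite tupleOfK.
rewrite /expect (bigD1 (tupleOf z)) /= ?zr // big1 ?addr0.
  rewrite -(@plancherel_planch 0 z (nseq N 0%N)) ?size_nseq //; last by case/andP: zP.
    rewrite /plancherel /hookProd big1; last by move=> i _; rewrite nth_nseq if_same big_ord0.
    by rewrite exp1n divr1 mul1r.
  by move=> i; rewrite nth_nseq if_same.
move=> t /andP[ht /eqP[]]; apply: (can_inj (@rowFunK m)); rewrite zr.
by apply/funext => i; apply/eqP; rewrite -leqn0 (isPart_le ht).
Qed.

Lemma contentSum_addBox r la i : S r (addBox la i) = S r la + x la i ^+ r.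
Proof.
rewrite /contentSum /boxSum (bigD1 i) //= [in RHS](bigD1 i) //= [RHS]addrAC; congr (_ + _).
  by rewrite /addBox eqxx addn1 big_ord_recr.
by apply: eq_bigr => j ji; rewrite /addBox (negbTE ji) addn0.
Qed.

Lemma isPart_S0 k la : isPart k la -> S 0 la = k%:R.
Proof. by case/andP => _ /eqP <-; rewrite contentSum0. Qed.

(** [upMoment (x la) 4] from [upMoments] with [S 0 la = k]; [sixthMoment] is likewise
    [upMoment (x la) 6]. *)
Definition fourthMoment k la : R := 3 * S 2 la + (k%:R + k%:R ^+ 2) / 2.

Definition sixthMoment k la : R := 5 * S 4 la + 5 * S 2 la + k%:R / 3 + 3 * k%:R * S 2 la
      + 2 * S 1 la ^+ 2 + k%:R ^+ 2 / 2 + k%:R ^+ 3 / 6.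

Lemma upMean_poly k la (g : 'I_N -> R) a0 a1 a2 a3 a4 a6 : isPart k la -> (k <= m)%N ->
  (forall i, g i = a0 + a1 * x la i + a2 * x la i ^+ 2 + a3 * x la i ^+ 3
                   + a4 * x la i ^+ 4 + a6 * x la i ^+ 6) ->
  upMean la g = a0 + a2 * k%:R + a3 * (2 * S 1 la) + a4 * fourthMoment k la
                + a6 * sixthMoment k la.
Proof.
move=> hk km hg.
have [u0 u1 u2 u3 [u4 u6]] := upMoments R (proj1 (andP hk)) (isPart_last hk km).
rewrite /fourthMoment /sixthMoment -(isPart_S0 hk).
rewrite -[LHS](_ : a0 * upMoment (x la) 0 + a1 * upMoment (x la) 1 + a2 * upMoment (x la) 2
   + a3 * upMoment (x la) 3 + a4 * upMoment (x la) 4 + a6 * upMoment (x la) 6 = _).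
  by rewrite u0 u1 u2 u3 u4 u6; ring.
rewrite /upMoment !mulr_sumr -!big_split /=; apply: eq_bigr => i _.
by rewrite hg; ring.
Qed.

Lemma expect_step k (f h : ('I_N -> nat) -> R) : (k <= m)%N ->
  (forall la, isPart k la -> upMean la (fun i => f (addBox la i)) = h la) ->
  expect k.+1 f = expect k h.
Proof. by move=> km e; rewrite expect_succ //; apply: eq_expect. Qed.

Lemma expect_1 k : (k <= N)%N -> expect k (fun _ : 'I_N -> nat => 1) = 1 :> R.
Proof.
elim: k => [|k IH] kN; first by rewrite expect0.
rewrite (@expect_step _ _ (fun=> 1)) // ?IH ?(ltnW kN) // => la hk.
by rewrite (@upMean_poly k la _ 1 0 0 0 0 0) //; move=> *; ring.
Qed.

Lemma expect_const k c : (k <= N)%N -> expect k (fun _ : 'I_N -> nat => c) = c :> R.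
Proof.
move=> kN; rewrite -[RHS]mulr1 -(expect_1 kN) -expectZ.
by apply: eq_expect => la _; rewrite mulr1.
Qed.

Lemma contentSum_zero r : S r (fun _ : 'I_N => 0%N) = 0.
Proof. by rewrite /contentSum /boxSum big1 // => i _; rewrite big_ord0. Qed.

Lemma expect_S2 k : (k <= N)%N -> expect k (fun la : 'I_N -> nat => S 2 la) = k%:R * (k%:R - 1) / 2.
Proof.
elim: k => [|k IH] kN; first by rewrite expect0 contentSum_zero !mul0r.
rewrite (@expect_step _ _ (fun la => S 2 la + k%:R)) // => [|la hk].
  by rewrite expectD expect_const 1?ltnW // IH 1?ltnW // -[k.+1%:R]natr1; field.
rewrite (@upMean_poly k la _ (S 2 la) 0 1 0 0 0) //; first by ring.
by move=> i; rewrite contentSum_addBox; ring.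
Qed.

(** Along the growth [S 1] is a martingale whose step has conditional variance [k]. The value at [N]
    is the square of the normalisation of T_n, which thus has variance 1. *)
Lemma expect_S1sq k : (k <= N)%N -> expect k (fun la : 'I_N -> nat => S 1 la ^+ 2) = k%:R * (k%:R - 1) / 2.
Proof.
elim: k => [|k IH] kN; first by rewrite expect0 contentSum_zero !mul0r expr0n.
rewrite (@expect_step _ _ (fun la => S 1 la ^+ 2 + k%:R)) // => [|la hk].
  by rewrite expectD expect_const 1?ltnW // IH 1?ltnW // -[k.+1%:R]natr1; field.
rewrite (@upMean_poly k la _ (S 1 la ^+ 2) (2 * S 1 la) 1 0 0 0) //; first by ring.
by move=> i; rewrite contentSum_addBox; ring.
Qed.

Lemma expect_fourthMoment k : (k <= N)%N -> expect k (fourthMoment k) = 2 * k%:R ^+ 2 - k%:R.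
Proof.
by move=> kN; rewrite /fourthMoment expectD expectZ expect_const // expect_S2 //; field.
Qed.

(** The centred [S 2] is a martingale, since the step has conditional mean [k]. The mean square of
    the centred step is [expect k (fourthMoment k) - k ^+ 2 = k ^+ 2 - k]. *)
Lemma expect_S2_var k : (k <= N)%N ->
  expect k (fun la : 'I_N -> nat => (S 2 la - k%:R * (k%:R - 1) / 2) ^+ 2) <= k%:R ^+ 3.
Proof.
elim: k => [|k IH] kN; first by rewrite expect0 contentSum_zero !mul0r subrr !expr0n.
rewrite (@expect_step _ _ (fun la => (S 2 la - k%:R * (k%:R - 1) / 2) ^+ 2
     + (fourthMoment k la + - k%:R ^+ 2))) // => [|la hk].
  rewrite 2!expectD expect_const 1?ltnW // expect_fourthMoment 1?ltnW // -[k.+1%:R]natr1.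
  have := IH (ltnW kN); have : 0 <= k%:R :> R by []; nra.
rewrite (@upMean_poly k la _ ((S 2 la - k.+1%:R * (k.+1%:R - 1) / 2) ^+ 2) 0
  (2 * (S 2 la - k.+1%:R * (k.+1%:R - 1) / 2)) 0 1 0) //  -?[k.+1%:R]natr1; first by field.
by move=> i; rewrite contentSum_addBox; field.
Qed.

Lemma expect_S4 k : (k <= N)%N -> expect k (fun la : 'I_N -> nat => S 4 la) <= k%:R ^+ 3.
Proof.
elim: k => [|k IH] kN; first by rewrite expect0 contentSum_zero expr0n.
rewrite (@expect_step _ _ (fun la => S 4 la + fourthMoment k la)) // => [|la hk].
  rewrite expectD expect_fourthMoment 1?ltnW // -[k.+1%:R]natr1.
  have := IH (ltnW kN); have : 0 <= k%:R :> R by []; nra.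
rewrite (@upMean_poly k la _ (S 4 la) 0 0 0 1 0) //; first by ring.
by move=> i; rewrite contentSum_addBox; ring.
Qed.

Lemma expect_S3S1 k : (k <= N)%N -> expect k (fun la : 'I_N -> nat => S 3 la * S 1 la) <= k%:R ^+ 3.
Proof.
elim: k => [|k IH] kN; first by rewrite expect0 !contentSum_zero mul0r expr0n.
rewrite (@expect_step _ _ (fun la => S 3 la * S 1 la + (2 * S 1 la ^+ 2 + fourthMoment k la)))
  // => [|la hk].
  rewrite 2!expectD expectZ expect_S1sq ?expect_fourthMoment 1?ltnW // -[k.+1%:R]natr1.
  have := IH (ltnW kN); have : 0 <= k%:R :> R by []; nra.
rewrite (@upMean_poly k la _ (S 3 la * S 1 la) (S 3 la) 0 (S 1 la) 1 0) //; first by ring.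
by move=> i; rewrite !contentSum_addBox; ring.
Qed.

Lemma expect_sixthMoment k : (k <= N)%N -> expect k (sixthMoment k) <= 12 * k%:R ^+ 3.
Proof.
move=> kN; rewrite /sixthMoment !expectD !expectZ !expect_const // expect_S2 // expect_S1sq //.
have := expect_S4 kN; case: k {kN} => [|k]; first by rewrite !mul0r !expr0n /=; lra.
have : 1 <= k.+1%:R :> R by rewrite ler1n.
nra.
Qed.

(** Unlike [S 1], [S 3] has a drift, namely [2 * S 1], which produces the cross term [S 3 * S 1];
    the square of the step gives the sixth moment. *)
Lemma expect_S3sq k : (k <= N)%N -> expect k (fun la : 'I_N -> nat => S 3 la ^+ 2) <= 4 * k%:R ^+ 4.
Proof.
elim: k => [|k IH] kN; first by rewrite expect0 contentSum_zero !expr0n mulr0.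
rewrite (@expect_step _ _ (fun la => S 3 la ^+ 2 + (4 * (S 3 la * S 1 la) + sixthMoment k la)))
  // => [|la hk].
  rewrite 2!expectD expectZ -[k.+1%:R]natr1.
  have := IH (ltnW kN); have := expect_S3S1 (ltnW kN); have := expect_sixthMoment (ltnW kN).
  have : 0 <= k%:R :> R by [].
  move: (k%:R : R) => y y0 h1 h2 h3.
  (* The term [16 * y ^+ 3] absorbs exactly [4 * y ^+ 3] from the cross term and [12 * y ^+ 3] from
     the sixth moment: this fixes the constant 4. *)
  have -> : 4 * (y + 1) ^+ 4 = 4 * y ^+ 4 + 16 * y ^+ 3 + (24 * y ^+ 2 + 16 * y + 4) by ring.
  have : 0 <= y ^+ 2 by exact: sqr_ge0.
  lra.
rewrite (@upMean_poly k la _ (S 3 la ^+ 2) 0 0 (2 * S 3 la) 0 1) //; first by ring.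
by move=> i; rewrite contentSum_addBox; ring.
Qed.

End PlancherelMoments.

(** * Stein's method for exchangeable pairs *)

Section SteinExchangeable.
Variables (R : realFieldType) (Om : finType) (w W W' A B : Om -> R) (l d : R).
Hypothesis w_ge0 : forall o, 0 <= w o.
Hypothesis w_sum1 : \sum_o w o = 1.
Hypothesis exchangeable : forall F : R -> R -> R,
  \sum_o w o * F (W o) (W' o) = \sum_o w o * F (W' o) (W o).
Hypothesis l_gt0 : 0 < l.
Hypothesis d_gt0 : 0 < d.
Hypothesis regression : forall h : R -> R,
  \sum_o w o * ((W' o - W o) * h (W o)) = - l * \sum_o w o * (W o * h (W o)).
Hypothesis cond_square : forall h : R -> R,
  \sum_o w o * ((W' o - W o) ^+ 2 * h (W o)) = \sum_o w o * (A o * h (W o)).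
Hypothesis cond_cube : forall h : R -> R,
  \sum_o w o * ((W' o - W o) ^+ 3 * h (W o)) = \sum_o w o * (B o * h (W o)).

Let Ex (X : Om -> R) : R := \sum_o w o * X o.

Let ExD X Y : Ex (fun o => X o + Y o) = Ex X + Ex Y.
Proof. by rewrite -big_split; apply: eq_bigr => o _; rewrite mulrDr. Qed.

Let ExB X Y : Ex (fun o => X o - Y o) = Ex X - Ex Y.
Proof. by rewrite -sumrB; apply: eq_bigr => o _; rewrite mulrBr. Qed.

Let ExZ a X : Ex (fun o => a * X o) = a * Ex X.
Proof. by rewrite mulr_sumr; apply: eq_bigr => o _; rewrite mulrCA. Qed.

Let Ex_eq X Y : X =1 Y -> Ex X = Ex Y.
Proof. by move=> e; apply: eq_bigr => o _; rewrite e. Qed.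

Let Ex_le X Y : (forall o, X o <= Y o) -> Ex X <= Ex Y.
Proof. by move=> h; apply: ler_sum => o _; rewrite ler_wpM2l. Qed.

Let Ex_norm X : `|Ex X| <= Ex (fun o => `|X o|).
Proof.
apply: le_trans (ler_norm_sum _ _ _) _; apply: ler_sum => o _.
by rewrite normrM ger0_norm.
Qed.

Variables (f f1 G : R -> R) (z p : R).
Hypothesis stein_eq : forall x, f1 x - x * f x = (x <= z)%R%:R - p.
Hypothesis f1_bound : forall x, `|f1 x| <= 2.
Hypothesis G_bound : forall x, `|G x| <= 2.
(* f is the Stein solution, f1 its derivative, G x = x f x - 1(x <= z): f1 is, up to
   the constant p, the sum of a nondecreasing and a nonincreasing function whose
   difference is G, and this alone controls the Taylor remainder. *)
Hypothesis taylor : forall x y, `|f y - f x - (y - x) * f1 x| <= (y - x) * (G y - G x).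

(** [A] and [B] act as conditional second and third moments of the increment, tested against
    functions of [W]. The free parameter [d] is the scale at which linear and cubic terms in the
    increment are balanced. *)
Lemma stein_bound :
  `| Ex (fun o => (W o <= z)%R%:R) - p |
  <= 2 * Ex (fun o => `|1 - A o / (2 * l)|) + d * Ex (fun o => `|W o|)
     + (l * d)^-1 * Ex (fun o => `|B o|).
Proof.
pose D o := f (W' o) - f (W o) - (W' o - W o) * f1 (W o).
pose Del o := W' o - W o.
(* The integrand is antisymmetric in [W], [W']. *)
have e0 : Ex (fun o => Del o * (f (W' o) + f (W o))) = 0.
  have := exchangeable (fun x y => (y - x) * (f y + f x)).
  rewrite -/(Ex _) => e.
  have : Ex (fun o => Del o * (f (W' o) + f (W o))) = - Ex (fun o => Del o * (f (W' o) + f (W o))).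
    rewrite {1}/Ex {1}/Del e -[RHS]mulN1r -ExZ.
    by apply: Ex_eq => o; rewrite /Del; ring.
  lra.
have e1 : Ex (fun o => W o * f (W o)) = (2 * l)^-1 * (Ex (fun o => A o * f1 (W o)) + Ex (fun o => Del o * D o)).
  have := e0.
  rewrite (@Ex_eq _ (fun o => 2 * (Del o * f (W o)) + (Del o ^+ 2 * f1 (W o) + Del o * D o))); last first.
    by move=> o; rewrite /D /Del; ring.
  rewrite !ExD ExZ /Ex regression cond_square => e2.
  apply: (@mulfI _ (2 * l)); first by rewrite mulf_neq0 // gt_eqF.
  rewrite mulrA divff ?mul1r ?mulf_neq0 ?gt_eqF //; lra.
have e3 : Ex (fun o => (W o <= z)%R%:R) - p
    = Ex (fun o => f1 (W o) * (1 - A o / (2 * l))) - (2 * l)^-1 * Ex (fun o => Del o * D o).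
  have -> : Ex (fun o => (W o <= z)%R%:R) - p = Ex (fun o => f1 (W o)) - Ex (fun o => W o * f (W o)).
    have -> : p = Ex (fun=> p) by rewrite /Ex -mulr_suml w_sum1 mul1r.
    rewrite -!ExB; apply: Ex_eq => o.
    by have := stein_eq (W o); lra.
  rewrite e1 mulrDr opprD addrA -ExZ; congr (_ - _).
  by rewrite -ExB; apply: Ex_eq => o; field; rewrite gt_eqF.
have e4 : `|Ex (fun o => Del o * D o)|
    <= 2 * l * d * Ex (fun o => `|W o|) + 2 / d * Ex (fun o => `|B o|).
  (* AM-GM: [|Del| <= d / 2 + Del^2 / (2 d)] *)
  pose U o := d / 2 + Del o ^+ 2 / (2 * d).
  have DelU o : `|Del o| <= U o.
    rewrite /U -subr_ge0 -[Del o ^+ 2]real_normK ?num_real //.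
    have -> : d / 2 + `|Del o| ^+ 2 / (2 * d) - `|Del o| = (d - `|Del o|) ^+ 2 / (2 * d).
      by field; rewrite gt_eqF.
    by rewrite divr_ge0 ?sqr_ge0 ?mulr_ge0 // ltW.
  have s1 : Ex (fun o => `|Del o * D o|) <= Ex (fun o => U o * (Del o * (G (W' o) - G (W o)))).
    by apply: Ex_le => o; rewrite normrM; apply: ler_pM => //; apply: DelU || apply: taylor.
  (* [U] is even in the increment, so swapping [W] and [W'] moves [G] from [W'] to [W] at the price
     of a sign. *)
  have s2 : Ex (fun o => U o * (Del o * (G (W' o) - G (W o))))
     = - 2 * Ex (fun o => U o * (Del o * G (W o))).
    have := exchangeable (fun x y => (d / 2 + (y - x) ^+ 2 / (2 * d)) * ((y - x) * G y)).
    rewrite (@Ex_eq _ (fun o => U o * (Del o * G (W' o)) + -1 * (U o * (Del o * G (W o))))); last first.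
      by move=> o; ring.
    rewrite ExD ExZ => e; rewrite {1}/Ex /U /Del e.
    have -> : \sum_o w o * ((d / 2 + (W o - W' o) ^+ 2 / (2 * d)) * ((W o - W' o) * G (W o)))
       = -1 * Ex (fun o => (d / 2 + (W' o - W o) ^+ 2 / (2 * d)) * ((W' o - W o) * G (W o))).
      rewrite -ExZ; apply: Ex_eq => o; rewrite -[W' o - W o]opprB; ring.
    by ring.
  (* [U * Del] is a combination of [Del] and [Del ^+ 3], whose conditional means are [- l * W] and
     [B]. *)
  have s3 : Ex (fun o => U o * (Del o * G (W o)))
     = Ex (fun o => (- (l * d / 2) * W o + B o / (2 * d)) * G (W o)).
    rewrite (@Ex_eq _ (fun o => d / 2 * (Del o * G (W o)) + (2 * d)^-1 * (Del o ^+ 3 * G (W o)))); last first.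
      by move=> o; rewrite /U; ring.
    rewrite ExD !ExZ /Ex regression cond_cube -!/(Ex _).
    rewrite -!ExZ -ExD -[LHS]/(Ex _); apply: Ex_eq => o; ring.
  apply: (le_trans (Ex_norm _)); apply: (le_trans s1); rewrite s2 s3.
  apply: (le_trans (ler_norm _)); rewrite normrM normrN normr_nat.
  have : `|Ex (fun o => (- (l * d / 2) * W o + B o / (2 * d)) * G (W o))|
     <= Ex (fun o => l * d * `|W o| + d^-1 * `|B o|).
    apply: (le_trans (Ex_norm _)); apply: Ex_le => o; rewrite normrM.
    have -> : l * d * `|W o| + d^-1 * `|B o| = (l * d / 2 * `|W o| + (2 * d)^-1 * `|B o|) * 2.
      by field; rewrite gt_eqF.
    have a1 : `|- (l * d / 2) * W o| = l * d / 2 * `|W o|.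
      have pos : 0 < l * d / 2 by rewrite divr_gt0 ?mulr_gt0.
      by rewrite normrM normrN (gtr0_norm pos).
    have a2 : `|B o / (2 * d)| = (2 * d)^-1 * `|B o|.
      have pos : 0 < (2 * d)^-1 by rewrite invr_gt0 mulr_gt0.
      by rewrite normrM mulrC (gtr0_norm pos).
    by rewrite ler_pM // -a1 -a2 ler_normD.
  rewrite ExD !ExZ => h; have := ler_wpM2l (ler0n R 2) h.
  by rewrite mulrDr !mulrA.
rewrite e3; apply: (le_trans (ler_normB _ _)); rewrite -addrA; apply: lerD.
  apply: (le_trans (Ex_norm _)); rewrite -ExZ; apply: Ex_le => o.
  by rewrite normrM ler_wpM2r.
have l0 : 0 < 2 * l by rewrite mulr_gt0.
rewrite normrM gtr0_norm ?invr_gt0 //.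
have := ler_wpM2l (ltW (_ : 0 < (2 * l)^-1)) e4; rewrite invr_gt0 => /(_ l0) /le_trans; apply.
rewrite le_eqVlt; apply/orP; left; apply/eqP.
by field; rewrite ?gt_eqF.
Qed.

End SteinExchangeable.

(** * Mills ratio *)

Section Mills.
Import numFieldNormedType.Exports.
Local Open Scope classical_set_scope.
Local Open Scope ring_scope.
Variable R : realType.
Implicit Types x y w v : R.

Lemma MVT_le (f f' : R -> R) (a b m M : R) : a <= b ->
  (forall x, a <= x <= b -> is_derive x 1 f (f' x)) ->
  (forall x, a <= x <= b -> m <= f' x <= M) ->
  (b - a) * m <= f b - f a <= (b - a) * M.
Proof.
move=> ab df bnd.
have io x : x \in `]a, b[ -> a <= x <= b.
  by rewrite in_itv /= => /andP[/ltW -> /ltW ->].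
have [|c cab ->] := @MVT_segment R f f' a b ab (fun x h => df x (io x h)).
  apply: derivable_within_continuous => x; rewrite in_itv /= => h.
  by have := df x h => -[].
rewrite in_itv /= in cab; have /andP[h1 h2] := bnd _ cab.
by rewrite [f' c * _]mulrC !ler_wpM2l ?subr_ge0.
Qed.

Lemma nondecreasing_from_derive (f f' : R -> R) (a b : R) : a <= b ->
  (forall x, a <= x <= b -> is_derive x 1 f (f' x)) ->
  (forall x, a <= x <= b -> 0 <= f' x) -> f a <= f b.
Proof.
move=> ab df h; rewrite -subr_ge0.
have io x : x \in `]a, b[ -> a <= x <= b.
  by rewrite in_itv /= => /andP[/ltW -> /ltW ->].
have [|c cab ->] := @MVT_segment R f f' a b ab (fun x h => df x (io x h)).
  apply: derivable_within_continuous => x; rewrite in_itv /= => hx.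
  by have := df x hx => -[].
by rewrite in_itv /= in cab; rewrite mulr_ge0 ?h // subr_ge0.
Qed.

Variables (k : R) (Psi : R -> R).
Hypothesis k_gt0 : 0 < k.

Definition gdens x : R := k * expR (- (x ^+ 2) / 2).

Lemma gdens_ge0 x : 0 <= gdens x.
Proof. by rewrite mulr_ge0 ?expR_ge0 // ltW. Qed.

Lemma is_derive_gdens x : is_derive x 1 gdens (- x * gdens x).
Proof. by apply: is_derive_eq; rewrite /gdens /GRing.scale /=; field. Qed.

Hypothesis dPsi : forall x, is_derive x 1 Psi (gdens x).
Hypothesis Psi_ge0 : forall x, 0 <= Psi x.
Hypothesis Psi_Ny : forall e, 0 < e -> exists v0, forall v, v <= v0 -> Psi v < e.

(** [Psi / gdens]. With [Psi] abstract, the same estimates serve the lower tail and the reflected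
    upper tail of the normal law. *)
Definition mills x : R := expR (x ^+ 2 / 2) * Psi x / k.

Lemma is_derive_mills x : is_derive x 1 mills (x * mills x + 1).
Proof.
apply: is_derive_eq; rewrite /mills /gdens /GRing.scale /=.
have -> : expR (- x ^+ 2 / 2) = (expR (x ^+ 2 / 2))^-1 by rewrite -expRN mulNr.
by have e0 := expR_gt0 (x ^+ 2 / 2); field; rewrite !gt_eqF.
Qed.

(** With [w] frozen, [gdens t + w * Psi t] has derivative [(w - t) * gdens t], nonnegative for
    [t <= w], and only [Psi t -> 0] at minus infinity is required, not [t * Psi t -> 0]. *)
Lemma gdens_mills_ge0 w : w <= 0 -> 0 <= gdens w + w * Psi w.
Proof.
move=> w0; rewrite leNgt; apply/negP => neg.
have w_lt0 : w < 0.
  rewrite lt_neqAle w0 andbT; apply: contraTneq neg => ->.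
  by rewrite mul0r addr0 -leNgt gdens_ge0.
pose e := (gdens w + w * Psi w) / w.
have e_gt0 : 0 < e by rewrite /e -mulrNN mulr_gt0 ?oppr_gt0 // invr_lt0.
have [v0 hv0] := Psi_Ny e_gt0.
pose v := Num.min v0 w.
have vw : v <= w by rewrite ge_min lexx orbT.
have := hv0 v; rewrite ge_min lexx => /(_ isT) hv.
have : gdens v + w * Psi v <= gdens w + w * Psi w.
  apply: (@nondecreasing_from_derive (fun t => gdens t + w * Psi t)
    (fun t => - t * gdens t + w * gdens t)) => // t /andP[vt tw].
    have := is_derive_gdens t; have := dPsi t => h1 h2.
    by apply: is_derive_eq; rewrite /GRing.scale /=.
  by rewrite -mulrDl mulr_ge0 ?gdens_ge0 // addrC subr_ge0.
apply/negP; rewrite -ltNge.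
have -> : gdens w + w * Psi w = w * e by rewrite /e [RHS]mulrC divfK // lt_eqF.
apply: (@lt_le_trans _ _ (w * Psi v)); first by rewrite ltr_nM2l.
by rewrite lerDr gdens_ge0.
Qed.

(** The derivative is twice the quantity of [gdens_mills_ge0], and far to the left the expression is
    at least [v * gdens v], which tends to 0. *)
Lemma gdens_mills_low w : 0 <= (1 + w ^+ 2) * Psi w + w * gdens w.
Proof.
rewrite leNgt; apply/negP => neg.
pose e := - ((1 + w ^+ 2) * Psi w + w * gdens w).
have e_gt0 : 0 < e by rewrite oppr_gt0.
pose v := Num.min w (- (2 * k / e + 1)).
have vw : v <= w by rewrite ge_min lexx.
have ve : v <= - (2 * k / e + 1) by rewrite ge_min lexx orbT.
have : (1 + v ^+ 2) * Psi v + v * gdens v <= (1 + w ^+ 2) * Psi w + w * gdens w.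
  apply: (@nondecreasing_from_derive (fun t => (1 + t ^+ 2) * Psi t + t * gdens t)
    (fun t => 2 * (gdens t + t * Psi t))) => // t _.
    have := is_derive_gdens t; have := dPsi t => h1 h2.
    by apply: is_derive_eq; rewrite /GRing.scale /=; ring.
  rewrite mulr_ge0 //; have [t0|t0] := leP t 0; first exact: gdens_mills_ge0.
  by rewrite addr_ge0 ?gdens_ge0 // mulr_ge0 // ltW.
apply/negP; rewrite -ltNge -[X in X < _]opprK -/e.
have ke : 0 < k / e by rewrite divr_gt0.
apply: (@lt_le_trans _ _ (v * gdens v)); last first.
  by rewrite lerDr mulr_ge0 // addr_ge0 // sqr_ge0.
have v_lt0 : v < 0 by rewrite (le_lt_trans ve) // oppr_lt0 -mulrA; lra.
(* [expR (v^2/2) >= v^2/2], so [-v * gdens v <= 2 k / -v < e] *)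
have E_gt0 := expR_gt0 (v ^+ 2 / 2).
have gE : gdens v * expR (v ^+ 2 / 2) = k.
  by rewrite /gdens mulNr expRN -mulrA mulVf ?mulr1 // gt_eqF.
have hE : 1 + v ^+ 2 / 2 <= expR (v ^+ 2 / 2) by exact: expR_ge1Dx.
rewrite -(ltr_pM2r E_gt0) -[X in _ < X]mulrA gE.
have hk : 2 * k < - v * e.
  have : 2 * k / e < - v by lra.
  by rewrite ltr_pdivrMr.
apply: (@le_lt_trans _ _ (- e * (1 + v ^+ 2 / 2))).
  by apply: ler_wnM2l => //; rewrite oppr_le0 ltW.
nra.
Qed.

Lemma mills_ge0 x : 0 <= mills x.
Proof. by rewrite divr_ge0 ?mulr_ge0 ?expR_ge0 // ltW. Qed.

Lemma mills_up w : w <= 0 -> -1 <= w * mills w.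
Proof.
move=> w0; have := mulr_ge0 (expR_ge0 (w ^+ 2 / 2)) (gdens_mills_ge0 w0).
have -> : expR (w ^+ 2 / 2) * (gdens w + w * Psi w) = k * (1 + w * mills w).
  rewrite /gdens /mills mulNr expRN; have e0 := expR_gt0 (w ^+ 2 / 2).
  by field; rewrite !gt_eqF.
by rewrite pmulr_rge0 //; lra.
Qed.

(** The expression is the derivative of [w * mills w]. *)
Lemma mills_low w : 0 <= (1 + w ^+ 2) * mills w + w.
Proof.
have := mulr_ge0 (expR_ge0 (w ^+ 2 / 2)) (gdens_mills_low w).
have -> : expR (w ^+ 2 / 2) * ((1 + w ^+ 2) * Psi w + w * gdens w)
    = k * ((1 + w ^+ 2) * mills w + w).
  rewrite /gdens /mills mulNr expRN; have e0 := expR_gt0 (w ^+ 2 / 2).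
  by field; rewrite !gt_eqF.
by rewrite pmulr_rge0.
Qed.

End Mills.

(** * The normal distribution function *)

Section NormalCDF.
Import numFieldNormedType.Exports.
Local Open Scope classical_set_scope.
Local Open Scope ring_scope.
Variable R : realType.
Implicit Types x : R.

Definition normalConst : R := (Num.sqrt (2 * pi))^-1.

Lemma normalConst_gt0 : 0 < normalConst.
Proof. by rewrite invr_gt0 sqrtr_gt0 mulr_gt0 ?pi_gt0. Qed.

Lemma normal_pdf_gdens x : normal_pdf 0 1 x = gdens normalConst x.
Proof.
rewrite normal_pdfE ?oner_eq0 // /normal_peak /normal_fun /gdens /normalConst.
by rewrite expr1n mul1r subr0 mulr_natl.
Qed.

Lemma integrable_gdens (A : set R) : measurable A ->
  (@lebesgue_measure R).-integrable A (EFin \o gdens normalConst).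
Proof.
move=> mA; apply: (@integrableS _ _ _ _ setT) => //.
have -> : gdens normalConst = normal_pdf 0 1 by apply/funext => x; rewrite normal_pdf_gdens.
exact: integrable_normal_pdf.
Qed.

Lemma normalCDF_Rintegral x :
  normalCDF x = Rintegral (@lebesgue_measure R) `]-oo, x]%classic (gdens normalConst).
Proof.
have i0 : (@lebesgue_measure R).-integrable `]-oo, x]
    (EFin \o (fun t : R => expR (- (t ^+ 2) / 2))).
  have -> : EFin \o (fun t : R => expR (- (t ^+ 2) / 2))
     = (fun t => (normalConst^-1)%:E * (EFin \o gdens normalConst) t)%E.
    apply/funext => t /=; rewrite /gdens -EFinM mulKf // gt_eqF // normalConst_gt0 //.
  by apply: integrableZl => //; apply: integrable_gdens.
by rewrite /normalCDF -RintegralZl.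
Qed.

Lemma normalCDF_prob x : normalCDF x = fine (normal_prob 0 1 `]-oo, x]).
Proof.
rewrite normalCDF_Rintegral /Rintegral /normal_prob; congr fine.
by apply: eq_integral => t _; rewrite normal_pdf_gdens.
Qed.

Lemma normalCDF_ge0 x : 0 <= normalCDF x.
Proof. by rewrite normalCDF_prob fine_ge0. Qed.

Lemma normalCDF_le1 x : normalCDF x <= 1.
Proof.
rewrite normalCDF_prob -lee_fin fineK ?fin_num_measure //.
exact: probability_le1.
Qed.

Lemma is_derive_normalCDF x : is_derive x 1 (@normalCDF R) (gdens normalConst x).
Proof.
have [||||d1 d2] := @continuous_FTC1 R (gdens normalConst) -oo%O x (x + 1).
- by rewrite ltrDl.
- exact: integrable_gdens.
- by rewrite ltNyr.
- have [d _] := is_derive_gdens normalConst x.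
  exact/differentiable_continuous/derivable1_diffP.
have e : @normalCDF R = (fun y => Rintegral (@lebesgue_measure R) `]-oo, y]%classic (gdens normalConst)).
  by apply/funext => y; rewrite normalCDF_Rintegral.
by rewrite e; split => //; rewrite -derive1E.
Qed.

(** The identity as a random variable under the normal law; its distribution function is
    [normalCDF], which gives access to the limits at both infinities. *)
Let idTR : measurableTypeR R -> R := idfun.
#[local] HB.instance Definition _ :=
  @isMeasurableFun.Build _ _ _ _ idTR (@measurable_id _ _ setT).

Let cdf_normal x : fine (cdf (idTR : {RV (normal_prob 0 1 : probability _ R) >-> R}) x) = normalCDF x.
Proof. by rewrite normalCDF_prob. Qed.

Lemma normalCDF_Ny (e : R) : 0 < e -> exists v0, forall v, v <= v0 -> normalCDF v < e.
Proof.
move=> e0.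
have lim : normalCDF x @[x --> -oo] --> (0 : R).
  under eq_fun => x do rewrite -cdf_normal.
  exact: fine_cvg (cvg_cdfNy0 _).
have [v0 [_ hv]] := (cvgrPdist_lt _ _).1 lim e e0.
exists (v0 - 1) => v hv0.
have /hv : v < v0 by rewrite (le_lt_trans hv0) // ltrBlDr ltrDl.
by rewrite /= sub0r normrN ger0_norm // normalCDF_ge0.
Qed.

(** Stated at [- v] so as to be the hypothesis [Psi_Ny] for the reflected tail. *)
Lemma normalCDF_y (e : R) : 0 < e -> exists v0, forall v, v <= v0 -> 1 - normalCDF (- v) < e.
Proof.
move=> e0.
have lim : normalCDF x @[x --> +oo] --> (1 : R).
  under eq_fun => x do rewrite -cdf_normal.
  exact: fine_cvg (cvg_cdfy1 _).
have [v0 [_ hv]] := (cvgrPdist_lt _ _).1 lim e e0.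
exists (- (v0 + 1)) => v hv0.
have /hv : v0 < - v by rewrite ltrNr (le_lt_trans hv0) // ltrN2 ltrDl.
by rewrite /= ger0_norm // subr_ge0 normalCDF_le1.
Qed.

Lemma is_derive_normalCDFC x : is_derive x 1 (fun y => 1 - normalCDF (- y)) (gdens normalConst x).
Proof.
have h := is_derive_normalCDF (- x).
have h2 : is_derive x 1 (fun y : R => normalCDF (- y)) (- gdens normalConst x).
  have := @is_derive1_comp R (@normalCDF R) -%R x _ _ h (is_deriveNid x 1).
  by rewrite /gdens sqrrN mulrN1.
by apply: is_derive_eq; rewrite add0r mul1r opprK.
Qed.

End NormalCDF.

(** * Solution of Stein's equation *)

Section SteinSolution.
Variables (R : realType) (z : R).
Implicit Types x y w a b c : R.

Let k := normalConst R.
Let k0 : 0 < k := normalConst_gt0 R.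
Let p : R := normalCDF z.
Let q : R := 1 - p.
Let Phic x : R := 1 - normalCDF (- x).
Let M1 := mills k (@normalCDF R).
Let M2 := mills k Phic.

Let p0 : 0 <= p. Proof. exact: normalCDF_ge0. Qed.
Let q0 : 0 <= q. Proof. by rewrite subr_ge0 normalCDF_le1. Qed.
Let Phic0 x : 0 <= Phic x. Proof. by rewrite subr_ge0 normalCDF_le1. Qed.

Let M1_ge0 x : 0 <= M1 x. Proof. exact: (mills_ge0 k0 (@normalCDF_ge0 R)). Qed.
Let M2_ge0 x : 0 <= M2 x. Proof. exact: (mills_ge0 k0 Phic0). Qed.

Let dM1 x : is_derive x 1 M1 (x * M1 x + 1).
Proof. exact: (is_derive_mills k0 (@is_derive_normalCDF R)). Qed.
Let dM2 x : is_derive x 1 M2 (x * M2 x + 1).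
Proof. exact: (is_derive_mills k0 (@is_derive_normalCDFC R)). Qed.

Let M1_low w : 0 <= (1 + w ^+ 2) * M1 w + w.
Proof.
exact: (mills_low k0 (@is_derive_normalCDF R) (@normalCDF_ge0 R) (@normalCDF_Ny R)).
Qed.
Let M2_low w : 0 <= (1 + w ^+ 2) * M2 w + w.
Proof. exact: (mills_low k0 (@is_derive_normalCDFC R) Phic0 (@normalCDF_y R)). Qed.

Let M1_up w : w <= 0 -> -1 <= w * M1 w.
Proof.
exact: (mills_up k0 (@is_derive_normalCDF R) (@normalCDF_Ny R)).
Qed.
Let M2_up w : w <= 0 -> -1 <= w * M2 w.
Proof. exact: (mills_up k0 (@is_derive_normalCDFC R) (@normalCDF_y R)). Qed.

(** With Phi the normal distribution function and phi its density, the branches of Stein's solution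
    are Phi(w) (1 - Phi(z)) / phi(w) below [z] and Phi(z) (1 - Phi(w)) / phi(w) above it. *)
Let F1 w := q * M1 w.
Let F2 w := p * M2 (- w).

Let dF1 w : is_derive w 1 F1 (w * F1 w + q).
Proof.
have h := dM1 w; apply: is_derive_eq.
by rewrite /F1 /GRing.scale /=; ring.
Qed.

Let dF2 w : is_derive w 1 F2 (w * F2 w - p).
Proof.
have h := @is_derive1_comp R M2 -%R w _ _ (dM2 (- w)) (is_deriveNid w 1).
have h2 : is_derive w 1 (fun y : R => M2 (- y)) ((- w * M2 (- w) + 1) * -1) by [].
by apply: is_derive_eq; rewrite /F2 /GRing.scale /=; ring.
Qed.

Let F12 : F1 z = F2 z.
Proof. by rewrite /F1 /F2 /M1 /M2 /mills /Phic opprK sqrrN -/p -/q; ring. Qed.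

Definition steinSol w : R := if w <= z then F1 w else F2 w.

Let steinSol2 w : z <= w -> steinSol w = F2 w.
Proof.
rewrite /steinSol => zw; case: ifP => // wz; have -> : w = z by apply/eqP; rewrite eq_le wz.
exact: F12.
Qed.

Let steinSol1 w : w <= z -> steinSol w = F1 w.
Proof. by rewrite /steinSol => ->. Qed.

Let g w : R := w * steinSol w.

Let g_mono1 a b : a <= b -> b <= z -> g a <= g b.
Proof.
move=> ab bz; rewrite /g !steinSol1 // ?(le_trans ab) //.
apply: (@nondecreasing_from_derive R (fun w => w * F1 w)
  (fun w => q * ((1 + w ^+ 2) * M1 w + w))); first exact: ab.
- move=> w _; have h := dF1 w.
  by apply: is_derive_eq; rewrite /F1 /GRing.scale /=; ring.
- by move=> w _; apply: mulr_ge0.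
Qed.

Let g_mono2 a b : a <= b -> z <= a -> g a <= g b.
Proof.
move=> ab za; rewrite /g !steinSol2 // ?(le_trans za) //.
apply: (@nondecreasing_from_derive R (fun w => w * F2 w)
  (fun w => p * ((1 + (- w) ^+ 2) * M2 (- w) + - w))); first exact: ab.
- move=> w _; have h := dF2 w.
  by apply: is_derive_eq; rewrite /F2 /GRing.scale /=; ring.
- by move=> w _; apply: mulr_ge0.
Qed.

Let g_mono a b : a <= b -> g a <= g b.
Proof.
move=> ab; have [bz|zb] := leP b z; first exact: g_mono1.
have [za|az] := leP z a; first exact: g_mono2.
by apply: (@le_trans _ _ (g z)); [apply: g_mono1 => //; exact: ltW|apply: g_mono2 => //; exact: ltW].
Qed.

Let p_le1 : p <= 1. Proof. exact: normalCDF_le1. Qed.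
Let q_le1 : q <= 1. Proof. by rewrite /q; have := p0; lra. Qed.

(** The Mills bounds apply only below min(z, 0) and above max(z, 0); monotonicity of [g] carries
    them to the interval between. *)
Let g_bound w : -1 <= g w <= 1.
Proof.
have low v : v <= z -> v <= 0 -> -1 <= g v.
  move=> vz v0; rewrite /g steinSol1 // /F1 mulrCA.
  by have := M1_up v0; have := mulr_le0_ge0 v0 (M1_ge0 v); have := q_le1; have := q0; nra.
have up v : z <= v -> 0 <= v -> g v <= 1.
  move=> zv v0; rewrite /g steinSol2 // /F2 mulrCA.
  have nv : - v <= 0 by rewrite oppr_le0.
  have := M2_up nv; have := mulr_ge0 v0 (M2_ge0 (- v)); have := p_le1; have := p0.
  rewrite mulNr; nra.
have s0 v : 0 <= steinSol v by rewrite /steinSol; case: ifP => _; apply: mulr_ge0.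
have [w0|w0] := leP 0 w.
  have g0 : 0 <= g w by rewrite mulr_ge0.
  apply/andP; split; first by apply: le_trans g0; rewrite lerN10.
  have [zw|wz] := leP z w; first exact: up.
  by apply: (le_trans (g_mono (ltW wz))); apply: up => //; apply: le_trans w0 (ltW wz).
have g0 : g w <= 0 by rewrite mulr_le0_ge0 // ltW.
apply/andP; split; last by apply: le_trans g0 _.
have [zw|wz] := leP z w; last by apply: low; exact: ltW.
apply: le_trans (g_mono zw); apply: low => //; exact: le_trans zw (ltW w0).
Qed.

Let I w : R := (w <= z)%R%:R.

(** Read off from Stein's equation, so that it has a value at the kink [z] too: the left
    derivative. *)
Definition steinDer w : R := g w + I w - p.

Definition steinMono w : R := g w - I w.

Lemma steinSol_eq w : steinDer w - w * steinSol w = (w <= z)%R%:R - p.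
Proof. by rewrite /steinDer /I /g; ring. Qed.

Let I_bound w : 0 <= I w <= 1.
Proof. by rewrite /I ler0n lern1 leq_b1. Qed.

Lemma steinDer_bound w : `|steinDer w| <= 2.
Proof.
rewrite ler_norml /steinDer; have := g_bound w; have := I_bound w; have := p0; have := p_le1.
move=> h1 h2 /andP[h3 h4] /andP[h5 h6]; apply/andP; split; lra.
Qed.

Lemma steinMono_bound w : `|steinMono w| <= 2.
Proof.
rewrite ler_norml /steinMono; have := g_bound w; have := I_bound w.
move=> /andP[h3 h4] /andP[h5 h6]; apply/andP; split; lra.
Qed.

Let I_mono a b : a <= b -> I b <= I a.
Proof.
by move=> ab; rewrite /I; case: (leP b z) => [bz|_]; rewrite ?ler0n // (le_trans ab).
Qed.

Let incr1 a b : a <= b -> b <= z ->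
  (b - a) * (g a + q) <= steinSol b - steinSol a <= (b - a) * (g b + q).
Proof.
move=> ab bz; rewrite !steinSol1 // ?(le_trans ab) //.
apply: (@MVT_le R F1 (fun w => w * F1 w + q)) => [|w _|w /andP[aw wb]].
- exact: ab.
- exact: dF1.
rewrite -(steinSol1 (le_trans wb bz)) -/(g w) !lerD2r.
by rewrite !g_mono.
Qed.

Let incr2 a b : a <= b -> z <= a ->
  (b - a) * (g a - p) <= steinSol b - steinSol a <= (b - a) * (g b - p).
Proof.
move=> ab za; rewrite !steinSol2 // ?(le_trans za) //.
apply: (@MVT_le R F2 (fun w => w * F2 w - p)) => [|w _|w /andP[aw wb]].
- exact: ab.
- exact: dF2.
rewrite -(steinSol2 (le_trans za aw)) -/(g w) !lerD2r.
by rewrite !g_mono.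
Qed.

(** Away from [z] the slope is [g + I - p] with [g] nondecreasing and [I] nonincreasing, so its
    lower bound takes [g] at [a] and [I] at [b]. If [z] lies strictly between, the increments over
    the two pieces are added. *)
Let incr a b : a <= b ->
  (b - a) * (g a + I b - p) <= steinSol b - steinSol a <= (b - a) * (g b + I a - p).
Proof.
move=> ab; have ba : 0 <= b - a by rewrite subr_ge0.
have [bz|zb] := leP b z.
  have Ib : I b = 1 by rewrite /I bz.
  have Ia : I a = 1 by rewrite /I (le_trans ab bz).
  by rewrite Ia Ib -!addrA; apply: incr1.
have [za|az] := leP z a.
  have := incr2 ab za => /andP[h1 h2]; have /andP[Ia _] := I_bound a.
  have -> : I b = 0 by rewrite /I leNgt zb.
  by rewrite addr0 h1 /=; apply: (le_trans h2); apply: ler_wpM2l => //; rewrite lerD2r lerDl.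
have := incr1 (ltW az) (lexx z); have := incr2 (ltW zb) (lexx z).
have -> : I b = 0 by rewrite /I leNgt zb.
have -> : I a = 1 by rewrite /I ltW.
have := g_mono (ltW az); have := g_mono (ltW zb); have := p0; have := q0; rewrite /q.
move: (g a) (g b) (g z) (steinSol a) (steinSol b) (steinSol z) (p) => ga gb gz sa sb sz r.
move=> r1 r0 g1 g2 /andP[h1 h2] /andP[h3 h4].
have za : 0 <= z - a by rewrite subr_ge0 ltW.
have bz : 0 <= b - z by rewrite subr_ge0 ltW.
have := mulr_ge0 za (_ : 0 <= gb - gz); have := mulr_ge0 bz (_ : 0 <= gz - ga).
rewrite !subr_ge0 => /(_ g2) m1 /(_ g1) m2.
by apply/andP; split; lra.
Qed.

(** The mean slope between [x] and [y] and the value [steinDer x] lie in one interval, given by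
    [incr], whose length is the absolute difference of [steinMono] at the two points. *)
Lemma steinSol_taylor x y :
  `|steinSol y - steinSol x - (y - x) * steinDer x| <= (y - x) * (steinMono y - steinMono x).
Proof.
rewrite ler_norml /steinDer /steinMono.
have [xy|/ltW xy] := leP x y.
all: have := incr xy; have := I_mono xy; have := g_mono xy.
all: move: (g x) (g y) (I x) (I y) (steinSol x) (steinSol y) (p) => gx gy Ix Iy sx sy r.
all: move=> hg hI /andP[h1 h2]; apply/andP; split; nra.
Qed.

End SteinSolution.

(** * Character ratios *)

Section CharacterRatio.

Lemma ltn_colLen (s : seq nat) i j : sorted geq s -> (i < colLen s j)%N = (j < nth 0%N s i)%N.
Proof.
have tr : transitive geq by move=> a b c ab bc; apply: leq_trans bc ab.
elim: s i => [|x s IH] i srt; first by rewrite nth_nil.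
rewrite /colLen /= -/(colLen s j).
have [jx|xj] := ltnP j x.
  by case: i => [|i] //=; rewrite add1n ltnS IH // (path_sorted srt).
have sx : all (geq x) s by move: srt; rewrite /= path_sortedE // => /andP[].
have -> : colLen s j = 0%N.
  apply/eqP; rewrite -leqn0 leqNgt -has_count; apply/hasPn => y /(allP sx) /= yx.
  by rewrite -leqNgt (leq_trans yx).
rewrite addn0 ltn0; apply/esym/negbTE; rewrite -leqNgt; case: i => [|i] //=.
have [is_|si] := ltnP i (size s); last by rewrite nth_default.
by apply: leq_trans xj; apply: (allP sx); rewrite mem_nth.
Qed.

Variables (R : realType) (m : nat).
Local Notation N := m.+1 (only parsing).
Notation x la := (shifted R la).
Notation S r la := (contentSum R r la).

(** In the sum of the contents [j - i], the [j] are summed row by row and the [i] column by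
    column. *)
Lemma frobenius_contents (la : 'I_N -> nat) (s : seq nat) : size s = N ->
  (forall i : 'I_N, nth 0%N s i = la i) -> nonincreasing la -> (forall i, la i <= N)%N ->
  \sum_(i < N) (('C(nth 0%N s i, 2))%:R - ('C(colLen s i, 2))%:R) = S 1 la.
Proof.
move=> sz hs h laN.
have srt : sorted geq s by exact: sorted_of_nonincreasing sz hs h.
have tri k : \sum_(j < k) (j : nat)%:R = ('C(k, 2))%:R :> R.
  by rewrite -triangular_sum big_mkord natr_sum.
have cs (j : 'I_N) : \sum_(i < N | (j < la i)%N) (i : nat)%:R = ('C(colLen s j, 2))%:R :> R.
  have cN : (colLen s j <= N)%N by apply: leq_trans (count_size _ _) _; rewrite sz.
  rewrite -tri (big_ord_widen _ _ cN); apply: eq_bigl => i.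
  by rewrite ltn_colLen // hs.
rewrite sumrB; under [X in _ - X]eq_bigr => j _ do rewrite -cs.
rewrite [X in _ - X](exchange_big_dep predT) //= -sumrB.
apply: eq_bigr => i _; rewrite hs -tri.
rewrite -(big_ord_widen N (fun=> i%:R) (laN i)) -sumrB.
by apply: eq_bigr => j _; rewrite expr1.
Qed.

End CharacterRatio.

(** * The exchangeable pair and the Berry-Esseen bound *)

Section BerryEsseen.
Variables (R : realType) (m : nat).
Hypothesis m_gt0 : (0 < m)%N.
Local Notation N := m.+1 (only parsing).
Implicit Types (la : 'I_N -> nat).
Notation x la := (shifted R la).
Notation S r la := (contentSum R r la).
Let n : R := N%:R.

(** [x la i - 1] is the content of the removed box. The formula for [g] is asked only of removable
    rows, since the weight vanishes on the others. *)
Lemma downMean_poly la (g : 'I_N -> R) b0 b1 b2 b3 : isPart N la ->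
  (forall i, (0 < la i)%N -> nonincreasing (remBox la i) ->
     g i = b0 + b1 * (x la i - 1) + b2 * (x la i - 1) ^+ 2 + b3 * (x la i - 1) ^+ 3) ->
  downMean N la g = b0 + b1 * (2 * S 1 la / n) + b2 * (3 * S 2 la / n + (1 - n) / 2)
    + b3 * ((4 * S 3 la + 2 * S 1 la) / n - 2 * S 1 la).
Proof.
move=> hla hg; have n0 : n != 0 by rewrite pnatr_eq0.
have [d0 d1 d2 d3] := downMoments R (proj1 (andP hla)).
rewrite (isPart_S0 R hla) -/n in d0 d1 d2 d3.
transitivity ((b0 * downMoment (x la) 0 + b1 * downMoment (x la) 1 + b2 * downMoment (x la) 2
   + b3 * downMoment (x la) 3) / n); last by rewrite d0 d1 d2 d3; field.
rewrite /downMoment !mulr_sumr -!big_split mulr_suml /=; apply: eq_bigr => i _.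
have [/andP[i0 hi]|hi] := boolP ((0 < la i)%N && nonincreasing (remBox la i)).
  by rewrite hg // -/n; field.
by rewrite downWeight_eq0 ?(proj1 (andP hla)) // !mul0r !mulr0 !addr0 mul0r.
Qed.

Let Om := (N.-tuple 'I_N.+1 * ('I_N * 'I_N))%type.

(* o = (mu, (i, j)): the two shapes are mu with a box added to row i, resp. row j. *)
Definition pairWeight (o : Om) : R :=
  if isPart m (rowFun o.1)
  then planch R m (rowFun o.1) * (upWeight (x (rowFun o.1)) o.2.1 * upWeight (x (rowFun o.1)) o.2.2)
  else 0.

Definition firstShape (o : Om) : 'I_N -> nat := addBox (rowFun o.1) o.2.1.
Definition secondShape (o : Om) : 'I_N -> nat := addBox (rowFun o.1) o.2.2.

Lemma pairWeight_ge0 o : 0 <= pairWeight o.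
Proof.
rewrite /pairWeight; case: ifP => // /andP[h _].
by rewrite mulr_ge0 ?planch_ge0 // mulr_ge0 // upWeight_ge0.
Qed.

Lemma sum_pairWeight (F : ('I_N -> nat) -> 'I_N -> 'I_N -> R) :
  \sum_o pairWeight o * F (rowFun o.1) o.2.1 o.2.2 =
  expect m (fun mu => upMean mu (fun i => upMean mu (F mu i))).
Proof.
rewrite /expect (big_mkcond (fun t => isPart m (rowFun t))) /=.
rewrite -(pair_bigA _ (fun t ij => pairWeight (t, ij) * F (rowFun t) ij.1 ij.2)) /=.
apply: eq_bigr => t _; rewrite /pairWeight /=; case: ifP => _; last first.
  by rewrite big1 // => ij _; rewrite mul0r.
rewrite -(pair_bigA _ (fun i j => planch R m (rowFun t) *
  (upWeight (x (rowFun t)) i * upWeight (x (rowFun t)) j) * F (rowFun t) i j)) /=.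
rewrite /upMean mulr_sumr; apply: eq_bigr => i _; rewrite !mulr_sumr; apply: eq_bigr => j _.
by ring.
Qed.

Lemma pair_marginal (f : ('I_N -> nat) -> R) :
  \sum_o pairWeight o * f (firstShape o) = expect N f.
Proof.
rewrite (sum_pairWeight (fun mu i _ => f (addBox mu i))) expect_succ //.
apply: eq_expect => mu hmu; apply: eq_bigr => i _; congr (_ * _).
by rewrite (@upMean_poly R m m mu _ (f (addBox mu i)) 0 0 0 0 0) //; move=> *; ring.
Qed.

(** Conditioning on the first shape is done by running its growth step backwards: a down step
    reaches the common smaller shape, from which the second shape grows independently. *)
Lemma pair_conditional (F : ('I_N -> nat) -> 'I_N -> 'I_N -> R) (Q : ('I_N -> nat) -> R)
    (h : ('I_N -> nat) -> R) :
  (forall la, isPart N la ->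
     downMean N la (fun i => upMean (remBox la i) (F (remBox la i) i)) = Q la) ->
  \sum_o pairWeight o * (F (rowFun o.1) o.2.1 o.2.2 * h (firstShape o))
  = \sum_o pairWeight o * (Q (firstShape o) * h (firstShape o)).
Proof.
move=> hQ; rewrite (pair_marginal (fun la => Q la * h la)).
rewrite (sum_pairWeight (fun mu i j => F mu i j * h (addBox mu i))) expect_balance //.
apply: eq_expect => la hla; rewrite -hQ // /downMean mulr_suml; apply: eq_bigr => i _.
have [i0|i0] := posnP (la i).
  by rewrite downWeight_eq0 ?i0 ?(proj1 (andP hla)) // !mul0r.
rewrite -[RHS]mulrA; congr (_ * _); rewrite /upMean mulr_suml; apply: eq_bigr => j _.
by rewrite remBoxK // mulrA.
Qed.

Let a : R := Num.sqrt ('C(N, 2))%:R.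

Let n_ge2 : 2 <= n. Proof. by rewrite /n ler_nat ltnS. Qed.

Let a_sqr : a ^+ 2 = n * (n - 1) / 2.
Proof.
rewrite sqr_sqrtr // bin2 /n.
have : ((N * N.-1)./2.*2 = N * N.-1)%N.
  by rewrite -[RHS]odd_double_half oddM /= andNb.
move/(congr1 (fun k => k%:R : R)); rewrite -muln2 !natrM /= -[m.+1%:R]natr1; lra.
Qed.

Let a_gt0 : 0 < a. Proof. by rewrite sqrtr_gt0 ltr0n bin_gt0. Qed.

Let Wn la : R := S 1 la / a.

Let Wdiff o : Wn (secondShape o) - Wn (firstShape o)
  = (x (rowFun o.1) o.2.2 - x (rowFun o.1) o.2.1) / a.
Proof. by rewrite /Wn /firstShape /secondShape !contentSum_addBox !expr1; ring. Qed.

Definition condSquare la : R := ((n - 1) / 2 + 3 * S 2 la / n) / a ^+ 2.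

Definition condCube la : R := - (2 * S 1 la + 4 * S 3 la / n) / a ^+ 3.

Let isPart_remBox la i : isPart N la -> (0 < la i)%N -> nonincreasing (remBox la i) ->
  isPart m (remBox la i).
Proof.
move=> /andP[_ /eqP sk] i0 h; rewrite /isPart h /=.
by move: sk; rewrite -{1}(remBoxK i0) sum_addBox => -[->].
Qed.

Let shifted_remBox la i : (0 < la i)%N -> x (remBox la i) i = x la i - 1.
Proof. by move=> i0; rewrite -{2}(remBoxK i0) shifted_addBox eqxx addrK. Qed.

Let S1_remBox la i : (0 < la i)%N -> S 1 (remBox la i) = S 1 la - (x la i - 1).
Proof.
by move=> i0; rewrite -{2}(remBoxK i0) contentSum_addBox shifted_remBox // expr1 addrK.
Qed.

Let m_real : m%:R = n - 1. Proof. by rewrite /n -natr1 addrK. Qed.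

(** The added content has conditional mean 0, so only the removed one counts, with mean
    [2 * S 1 la / n]. *)
Lemma pair_regression (h : R -> R) :
  \sum_o pairWeight o * ((Wn (secondShape o) - Wn (firstShape o)) * h (Wn (firstShape o)))
  = - (2 / n) * \sum_o pairWeight o * (Wn (firstShape o) * h (Wn (firstShape o))).
Proof.
under eq_bigr => o _ do rewrite Wdiff.
rewrite (@pair_conditional (fun mu i j => (x mu j - x mu i) / a) (fun la => - (2 / n) * Wn la)
  (fun la => h (Wn la))) => [|la hla].
  by rewrite mulr_sumr; apply: eq_bigr => o _; ring.
rewrite (@downMean_poly la _ 0 (- a^-1) 0 0) // => [|i i0 hi]; first by rewrite /Wn; ring.
rewrite (@upMean_poly R m m _ _ (- x (remBox la i) i / a) a^-1 0 0 0 0) ?isPart_remBox //.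
  by rewrite shifted_remBox //; ring.
by move=> j; ring.
Qed.

Lemma pair_condSquare (h : R -> R) :
  \sum_o pairWeight o * ((Wn (secondShape o) - Wn (firstShape o)) ^+ 2 * h (Wn (firstShape o)))
  = \sum_o pairWeight o * (condSquare (firstShape o) * h (Wn (firstShape o))).
Proof.
under eq_bigr => o _ do rewrite Wdiff.
apply: (@pair_conditional (fun mu i j => ((x mu j - x mu i) / a) ^+ 2) condSquare
  (fun la => h (Wn la))) => la hla.
have n0 : n != 0 by rewrite pnatr_eq0.
rewrite (@downMean_poly la _ (m%:R / a ^+ 2) 0 (a ^- 2) 0) // => [|i i0 hi].
  by rewrite /condSquare m_real; move: n0 (lt0r_neq0 a_gt0); move: (n) (a) => y b y0 b0; field; rewrite y0 b0.
rewrite (@upMean_poly R m m _ _ ((x (remBox la i) i) ^+ 2 / a ^+ 2)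
  (- 2 * x (remBox la i) i / a ^+ 2) (a ^- 2) 0 0 0) ?isPart_remBox //.
  by rewrite shifted_remBox //; ring.
by move=> j; field; rewrite gt_eqF.
Qed.

Lemma pair_condCube (h : R -> R) :
  \sum_o pairWeight o * ((Wn (secondShape o) - Wn (firstShape o)) ^+ 3 * h (Wn (firstShape o)))
  = \sum_o pairWeight o * (condCube (firstShape o) * h (Wn (firstShape o))).
Proof.
under eq_bigr => o _ do rewrite Wdiff.
apply: (@pair_conditional (fun mu i j => ((x mu j - x mu i) / a) ^+ 3) condCube
  (fun la => h (Wn la))) => la hla.
have n0 : n != 0 by rewrite pnatr_eq0.
(* The third moment of the added content is [2 * S 1] of the smaller shape, that is [2 * S 1 la]
   minus twice the removed content: hence the constant term and the 2 in [3 * m%:R + 2]. *)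
rewrite (@downMean_poly la _ (2 * S 1 la / a ^+ 3) (- (3 * m%:R + 2) / a ^+ 3) 0 (- a ^- 3)) //
   => [|i i0 hi].
  by rewrite /condCube m_real; move: n0 (lt0r_neq0 a_gt0); move: (n) (a) => y b y0 b0; field; rewrite y0 b0.
rewrite (@upMean_poly R m m _ _ (- (x (remBox la i) i) ^+ 3 / a ^+ 3)
  (3 * x (remBox la i) i ^+ 2 / a ^+ 3) (- 3 * x (remBox la i) i / a ^+ 3) (a ^- 3) 0 0)
  ?isPart_remBox //.
  by rewrite shifted_remBox // S1_remBox //; ring.
by move=> j; field; rewrite gt_eqF.
Qed.

Lemma pair_exchangeable (F : R -> R -> R) :
  \sum_o pairWeight o * F (Wn (firstShape o)) (Wn (secondShape o))
  = \sum_o pairWeight o * F (Wn (secondShape o)) (Wn (firstShape o)).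
Proof.
pose sw (o : Om) : Om := (o.1, (o.2.2, o.2.1)).
have swK : involutive sw by case=> t [i j].
rewrite (reindex_inj (inv_inj swK)); apply: eq_bigr => o _; congr (_ * _).
by rewrite /pairWeight /= [upWeight _ _ * _]mulrC.
Qed.

Lemma pair_sum1 : \sum_o pairWeight o = 1.
Proof.
rewrite -[RHS](expect_1 R (leqnn N)) -pair_marginal.
by apply: eq_bigr => o _; rewrite mulr1.
Qed.

Let y0 : 0 < n. Proof. exact: lt_le_trans n_ge2. Qed.
Let s : R := Num.sqrt n.
Let s0 : 0 < s. Proof. by rewrite sqrtr_gt0. Qed.
Let ss : s ^+ 2 = n. Proof. by rewrite sqr_sqrtr // ltW. Qed.

Lemma expect_normW : expect N (fun la => `|Wn la|) <= 1.
Proof.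
apply: (@le_trans _ _ (expect N (fun la => 2^-1 + (2 * a ^+ 2)^-1 * S 1 la ^+ 2))).
  apply: expect_le => la _; rewrite -subr_ge0.
  have -> : 2^-1 + (2 * a ^+ 2)^-1 * S 1 la ^+ 2 - `|Wn la| = (1 - `|Wn la|) ^+ 2 / 2.
    rewrite sqrrB expr1n mul1r real_normK ?num_real // /Wn; move: (a) a_gt0 => b b0.
    by field; rewrite gt_eqF.
  by rewrite divr_ge0 // sqr_ge0.
rewrite expectD expect_const // expectZ expect_S1sq // -/n -a_sqr.
have := lt0r_neq0 a_gt0; move: (a) => b b0.
by rewrite le_eqVlt; apply/orP; left; apply/eqP; field.
Qed.

(** The deviation is exactly [- 3 / (4 a^2)] times the centred [S 2] ([eE]). Its mean absolute value
    follows by AM-GM at the scale [n * s] = n^(3/2), the bound on the standard deviation of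
    [S 2]. *)
Lemma expect_condSquare :
  expect N (fun la => `|1 - condSquare la / (2 * (2 / n))|) <= 3 / s.
Proof.
have sn : 0 < n * s by rewrite mulr_gt0.
pose e la := S 2 la - n * (n - 1) / 2.
have eE la : 1 - condSquare la / (2 * (2 / n)) = - (3 / (4 * a ^+ 2)) * e la.
  rewrite /condSquare /e -a_sqr.
  have n1 : (n - 1) / 2 = a ^+ 2 / n by rewrite a_sqr; have := lt0r_neq0 y0; move: (n) => y h; field.
  rewrite n1; have := lt0r_neq0 y0; have := lt0r_neq0 a_gt0; move: (n) (a) => y b h1 h2.
  by field; rewrite h1 h2.
have b0 : 0 < 3 / (4 * a ^+ 2) by rewrite divr_gt0 // mulr_gt0 // exprn_gt0.
apply: (@le_trans _ _ (expect N (fun la => 3 / (4 * a ^+ 2) * (n * s / 2 + (2 * (n * s))^-1 * e la ^+ 2)))).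
  apply: expect_le => la _; rewrite eE normrM normrN (gtr0_norm b0) (ler_pM2l b0).
  rewrite -subr_ge0.
  have -> : n * s / 2 + (2 * (n * s))^-1 * e la ^+ 2 - `|e la| = (n * s - `|e la|) ^+ 2 / (2 * (n * s)).
    rewrite [in RHS]sqrrB real_normK ?num_real //; move: (e la) (n * s) sn => v c c0.
    by field; rewrite gt_eqF.
  by rewrite divr_ge0 ?sqr_ge0 // mulr_ge0 // ltW.
rewrite expectZ expectD expect_const // expectZ.
have := expect_S2_var R (leqnn N); rewrite -/n -/(e _) => v.
apply: (@le_trans _ _ (3 / (4 * a ^+ 2) * (n * s / 2 + (2 * (n * s))^-1 * n ^+ 3))).
  by rewrite (ler_pM2l b0) lerD2l; apply: ler_wpM2l v; rewrite invr_ge0 mulr_ge0 // ltW.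
rewrite a_sqr -ss.
have s2 : 2 <= s ^+ 2 by rewrite ss.
have -> : 3 / (4 * (s ^+ 2 * (s ^+ 2 - 1) / 2)) * (s ^+ 2 * s / 2 + (2 * (s ^+ 2 * s))^-1 * s ^+ 2 ^+ 3)
   = 3 / 2 * s / (s ^+ 2 - 1).
  move: (s) s0 s2 => u u0 u2; have h1 : u ^+ 2 - 1 != 0 by rewrite gt_eqF //; lra.
  by field; rewrite h1 gt_eqF.
rewrite ler_pdivrMr; last by lra.
rewrite [leRHS]mulrAC ler_pdivlMr //; move: (s) s0 s2 => u u0 u2; nra.
Qed.

Lemma expect_condCube : expect N (fun la => `|condCube la|) <= 88 / n ^+ 2.
Proof.
have a3 : 0 < a ^+ 3 by rewrite exprn_gt0.
have e1 : expect N (fun la => `|S 1 la|) <= a.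
  have := expect_normW; rewrite -(ler_pM2l a_gt0) -expectZ mulr1; apply: le_trans.
  apply: expect_le => la _; rewrite /Wn normrM normfV (gtr0_norm a_gt0) mulrC divfK //.
  by rewrite gt_eqF.
have e3 : expect N (fun la => `|S 3 la|) <= 5 / 2 * n ^+ 2.
  apply: (@le_trans _ _ (expect N (fun la => n ^+ 2 / 2 + (2 * n ^+ 2)^-1 * S 3 la ^+ 2))).
    apply: expect_le => la _; rewrite -subr_ge0.
    have -> : n ^+ 2 / 2 + (2 * n ^+ 2)^-1 * S 3 la ^+ 2 - `|S 3 la|
        = (n ^+ 2 - `|S 3 la|) ^+ 2 / (2 * n ^+ 2).
      rewrite [in RHS]sqrrB real_normK ?num_real //; have := lt0r_neq0 y0; move: (n) => y h.
      by field.
    by rewrite divr_ge0 ?sqr_ge0 // mulr_ge0 // sqr_ge0.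
  rewrite expectD expect_const // expectZ.
  apply: (@le_trans _ _ (n ^+ 2 / 2 + (2 * n ^+ 2)^-1 * (4 * n ^+ 4))).
    by rewrite lerD2l ler_wpM2l ?expect_S3sq // invr_ge0 mulr_ge0 // sqr_ge0.
  rewrite le_eqVlt; apply/orP; left; apply/eqP.
  by have := lt0r_neq0 y0; move: (n) => y h; field.
apply: (@le_trans _ _ ((2 * a + 10 * n) / a ^+ 3)).
  apply: (@le_trans _ _ (expect N (fun la => (2 / a ^+ 3) * `|S 1 la| + (4 / n / a ^+ 3) * `|S 3 la|))).
    apply: expect_le => la _; rewrite /condCube mulNr normrN normrM normfV (gtr0_norm a3).
    rewrite [leRHS](_ : _ = (2 * `|S 1 la| + 4 * `|S 3 la| / n) / a ^+ 3).
      by rewrite ler_pM2r ?invr_gt0 // (le_trans (ler_normD _ _)) // !normrM normfV !normr_nat.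
    by ring.
  rewrite expectD !expectZ.
  have c1 : 0 <= 2 / a ^+ 3 by rewrite divr_ge0 // ltW.
  have c3 : 0 <= 4 / n / a ^+ 3 by rewrite !divr_ge0 // ltW.
  apply: le_trans (lerD (ler_wpM2l c1 e1) (ler_wpM2l c3 e3)) _.
  rewrite le_eqVlt; apply/orP; left; apply/eqP.
  have := lt0r_neq0 y0; have := lt0r_neq0 a_gt0; move: (n) (a) => y b h1 h2.
  by field; rewrite h1 h2.
(* From [n <= 2 * a]: [2 / a ^+ 2 <= 8 / n ^+ 2] and [10 * n / a ^+ 3 <= 80 / n ^+ 2], whence 88. *)
have an : n / 2 <= a.
  have : (n / 2) ^+ 2 <= a ^+ 2.
    have := mulr_ge0 (ltW y0) (_ : 0 <= n - 2); rewrite subr_ge0 => /(_ n_ge2).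
    by rewrite a_sqr; move: (n) => y; lra.
  by rewrite ler_pXn2r // nnegrE ?divr_ge0 // ltW.
rewrite ler_pdivrMr // [leRHS]mulrAC ler_pdivlMr ?exprn_gt0 //.
move: (n) (a) y0 a_gt0 an => y b h1 h2 h3.
have t1 : y ^+ 2 <= 4 * b ^+ 2.
  rewrite -subr_ge0 (_ : _ - _ = (2 * b - y) * (2 * b + y)); last by ring.
  by rewrite mulr_ge0; lra.
have t2 : y * y ^+ 2 <= (2 * b) * (4 * b ^+ 2).
  by apply: ler_pM; rewrite ?sqr_ge0 //; lra.
have t3 : b * y ^+ 2 <= b * (4 * b ^+ 2) by rewrite ler_wpM2l // ltW.
have -> : b ^+ 3 = b * b ^+ 2 by rewrite exprS.
lra.
Qed.

Lemma probT_pair z :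
  probT N z = \sum_o pairWeight o * (Wn (firstShape o) <= z)%R%:R.
Proof.
rewrite (pair_marginal (fun la => (Wn la <= z)%R%:R)) /expect /probT.
rewrite [RHS](bigID (fun t => Wn (rowFun t) <= z)) /= [X in _ = _ + X]big1 ?addr0; last first.
  by move=> t /andP[_ /negbTE ->]; rewrite mulr0.
have nthr (t : N.-tuple 'I_N.+1) (i : 'I_N) : nth 0%N (rows t) i = rowFun t i.
  by rewrite /rows (nth_map ord0) ?size_tuple // /rowFun (tnth_nth ord0).
have szr (t : N.-tuple 'I_N.+1) : size (rows t) = N by rewrite size_map size_tuple.
have partE (t : N.-tuple 'I_N.+1) : is_partition N (rows t) = isPart N (rowFun t).
  rewrite /is_partition /isPart; congr (_ && _).
    apply/idP/idP => [srt|]; last exact: sorted_of_nonincreasing (szr t) (nthr t).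
    apply/nonincreasingP => i j ij; rewrite -!nthr.
    have tr : transitive geq by move=> p q r pq qr; apply: leq_trans qr pq.
    by apply: (sorted_leq_nth tr (@leqnn) 0%N srt) => //; rewrite inE szr.
  rewrite sumnE (big_nth 0%N) szr big_mkord.
  by congr (_ == _); apply: eq_bigr => i _; rewrite nthr.
have TnE t : isPart N (rowFun t) -> Tn N (rows t) = Wn (rowFun t).
  move=> ht; rewrite /Tn /charRatio (frobenius_contents R (szr t) (nthr t)); last 2 first.
  - by case/andP: ht.
  - by move=> i; rewrite /rowFun -ltnS.
  rewrite -/a /Wn; have -> : ('C(N, 2))%:R = a ^+ 2 by rewrite sqr_sqrtr.
  by have := lt0r_neq0 a_gt0; move: (a) => b h; field.
apply: eq_big => [t|t /andP[]].
  by rewrite partE; have [ht|//] := boolP (isPart N (rowFun t)); rewrite TnE.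
rewrite partE => ht; rewrite (TnE _ ht) => ->; rewrite mulr1.
by apply: plancherel_planch (szr t) (nthr t) _; case/andP: ht.
Qed.

(** [stein_bound] with [l = 2 / n] and [d] = n^(-1/2), the typical size of an increment. In units of
    n^(-1/2) the three terms contribute 2 * 3, 1 and 88 / 2, which add up to 51. *)
Lemma berry_esseen z : `|probT N z - normalCDF z| <= 51 * (Num.sqrt n)^-1.
Proof.
have l0 : 0 < 2 / n by rewrite divr_gt0.
have d0 : 0 < s^-1 by rewrite invr_gt0.
have := stein_bound pairWeight_ge0 pair_sum1 pair_exchangeable l0 d0 pair_regression
  pair_condSquare pair_condCube (steinSol_eq z) (steinDer_bound z) (steinMono_bound z)
  (@steinSol_taylor R z).
rewrite -probT_pair => /le_trans; apply.
rewrite (pair_marginal (fun la => `|1 - condSquare la / (2 * (2 / n))|)).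
rewrite (pair_marginal (fun la => `|Wn la|)) (pair_marginal (fun la => `|condCube la|)).
have h1 := ler_wpM2l (ler0n R 2) expect_condSquare.
have h2 := ler_wpM2l (ltW d0) expect_normW.
have ld : 0 < (2 / n / s)^-1 by rewrite invr_gt0 divr_gt0.
have h3 := ler_wpM2l (ltW ld) expect_condCube.
apply: le_trans (lerD (lerD h1 h2) h3) _; rewrite -/s -ss.
rewrite le_eqVlt; apply/orP; left; apply/eqP.
by move: (s) s0 => u u0; field; rewrite gt_eqF.
Qed.

End BerryEsseen.

Theorem theorem1 (R : realType) :
  exists C : R, forall (n : nat) (x0 : R), (2 <= n)%N ->
    `| probT n x0 - normalCDF x0 | <= C * (Num.sqrt (n%:R))^-1.
Proof.
by exists 51 => -[//|m] z m_gt0; apply: berry_esseen.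
Qed.
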